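(* Let $d\ge 1$ and let $\phi$ be a complete Bernstein function with no killing term and no drift, normalized by $\phi(1)=1$. Assume that there exist constants $0<\delta_1\le\delta_2<1$, $0<\delta_3\le\delta_4<1$ and $a_1,a_2,a_3,a_4>0$ such that $$a_1\Big(\frac{R}{r}\Big)^{\delta_1}\le \frac{\phi(R)}{\phi(r)}\le a_2\Big(\frac{R}{r}\Big)^{\delta_2}\quad (1\le r\le R),\qquad a_3\Big(\frac{R}{r}\Big)^{\delta_3}\le \frac{\phi(R)}{\phi(r)}\le a_4\Big(\frac{R}{r}\Big)^{\delta_4}\quad (0<r\le R\le 1).$$ Let $X$ be the subordinate Brownian motion in $\mathbb R^d$ with characteristic exponent $\phi(|\xi|^2)$, let $J(x)=j(|x|)$ be its L\'evy density and, when $X$ is transient, let $G(x)=g(|x|)$ be its Green function. (a) It holds that $J(x)\asymp |x|^{-d}\phi(|x|^{-2})$ for all $x\in\mathbb R^d$, $x\neq 0$. (b) If $d>2(\delta_2\vee\delta_4)$, then the process $X$ is transient and $G(x)\asymp |x|^{-d}\phi(|x|^{-2})^{-1}$ for all $x\in\mathbb R^d$, $x\ne 0$.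
   Context: A function $\phi:(0,\infty)\to(0,\infty)$ is a complete Bernstein function without killing and drift if $\phi(\lambda)=\int_0^\infty(1-e^{-\lambda t})\mu(t)\,dt$ where $\mu:(0,\infty)\to[0,\infty)$ is completely monotone and $\int_0^\infty(1\wedge t)\mu(t)\,dt<\infty$; $\mu(t)$ is the L\'evy density. $S=(S_t)_{t\ge0}$ is the subordinator with Laplace exponent $\phi$, i.e. $\mathbb E[e^{-\lambda S_t}]=e^{-t\phi(\lambda)}$. Its potential measure $U(A)=\mathbb E\int_0^\infty \mathbf 1_{\{S_t\in A\}}dt$ has a completely monotone density $u(t)$ on $(0,\infty)$. $W$ is a Brownian motion in $\mathbb R^d$ independent of $S$ with $\mathbb E_x[e^{i\xi\cdot(W_t-W_0)}]=e^{-t|\xi|^2}$, and $X_t=W(S_t)$. The L\'evy measure of $X$ has density $J(x)=j(|x|)$ with $j(r)=\int_0^\infty(4\pi t)^{-d/2}e^{-r^2/(4t)}\mu(t)\,dt$. If $X$ is transient, its mean occupation measure has density $G(x,y)=g(|x-y|)$ with $g(r)=\int_0^\infty(4\pi t)^{-d/2}e^{-r^2/(4t)}u(t)\,dt$; one writes $G(x)=g(|x|)$. The notation $f\asymp h$ means that there is a constant $c\ge1$ with $c^{-1}h\le f\le c\,h$ on the common domain. $a\vee b=\max\{a,b\}$, $a\wedge b=\min\{a,b\}$. *)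

(* Defs.v *)
From HB Require Import structures.
From mathcomp Require Import all_boot all_order all_algebra.
From mathcomp Require Import all_classical all_reals all_analysis.

Set Implicit Arguments.
Unset Strict Implicit.
Unset Printing Implicit Defensive.

Import Order.TTheory GRing.Theory Num.Theory.
Import numFieldNormedType.Exports.

Local Open Scope classical_set_scope.
Local Open Scope ring_scope.

(* The norm of 'rV[R]_d in the library is the sup norm, hence the following. *)
Definition dot (R : realType) (d : nat) (x y : 'rV[R]_d) : R :=
  \sum_(i < d) x 0 i * y 0 i.

Definition enorm (R : realType) (d : nat) (x : 'rV[R]_d) : R :=
  Num.sqrt (dot x x).

(* The comparison function h is real-valued, so comparability entails in
   particular that f is finite on D. *)
Definition comparable_on (R : realType) (T : Type) (D : set T)
    (f : T -> \bar R) (h : T -> R) : Prop :=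
  exists c : R, 1 <= c /\
    forall x, D x -> ((c^-1 * h x)%:E <= f x <= (c * h x)%:E)%E.

Definition completely_monotone (R : realType) (f : R -> R) : Prop :=
  forall (n : nat) (t : R), 0 < t ->
    derivable (derive1n n f) t 1 /\ 0 <= (-1) ^+ n * derive1n n f t.

(* phi is a complete Bernstein function without killing and drift, with Levy
   density mu. Only the values of phi and mu on (0, +oo) matter. *)
Definition complete_bernstein (R : realType) (phi mu : R -> R) : Prop :=
  [/\ forall lambda, 0 < lambda -> 0 < phi lambda,
      completely_monotone mu,
      (\int[lebesgue_measure]_(t in `]0%R, +oo[) (Num.min 1 t * mu t)%:E
         < +oo)%E
    & forall lambda, 0 < lambda ->
      ((phi lambda)%:E = \int[lebesgue_measure]_(t in `]0%R, +oo[)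
         ((1 - expR (- lambda * t)) * mu t)%:E)%E].

Definition borel (T : topologicalType) : set (set T) := <<s open >>.

(* The events generated by the E-valued variables Y t with t in D. *)
Definition generated_events (Omega I : Type) (E : topologicalType) (D : set I)
    (Y : I -> Omega -> E) : set (set Omega) :=
  <<s [set A | exists t B, [/\ D t, borel B & A = Y t @^-1` B]] >>.

Definition independent_events (R : realType) (dd : measure_display)
    (Omega : measurableType dd) (P : probability Omega R)
    (F G : set (set Omega)) : Prop :=
  forall A B, F A -> G B -> P (A `&` B) = (P A * P B)%E.

(* Levy process started at 0; a process is a family indexed by all of R of
   which only the restriction to nonnegative times is used. *)
Definition levy_process (R : realType) (dd : measure_display)
    (Omega : measurableType dd) (P : probability Omega R)
    (E : normedModType R) (Y : R -> Omega -> E) : Prop :=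
  (forall t B, 0 <= t -> borel B -> measurable (Y t @^-1` B)) /\
  [/\ forall w, Y 0 w = 0,
      forall s t, 0 <= s -> s <= t ->
        independent_events P
          (generated_events [set r | 0 <= r <= s] Y)
          (generated_events [set: unit] (fun _ w => Y t w - Y s w)),
      forall s t B, 0 <= s -> s <= t -> borel B ->
        P ((fun w => Y t w - Y s w) @^-1` B) = P (Y (t - s) @^-1` B),
      forall w t, 0 <= t -> Y r w @[r --> t^'+] --> Y t w
    & forall w t, 0 < t -> cvg (Y r w @[r --> t^'-])].

Definition subordinator (R : realType) (dd : measure_display)
    (Omega : measurableType dd) (P : probability Omega R) (phi : R -> R)
    (S : R -> Omega -> R) : Prop :=
  [/\ levy_process P S,
      forall w s t, 0 <= s -> s <= t -> S s w <= S t w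
    & forall lambda t, 0 < lambda -> 0 <= t ->
      ('E_P[fun w => expR (- lambda * S t w)]
        = (expR (- t * phi lambda))%:E)%E].

(* Brownian motion with generator the Laplacian, i.e. with variance 2t per
   coordinate; the last two clauses are the real and imaginary parts of
   E[exp(i xi.(W_t - W_0))] = exp(- t |xi|^2). *)
Definition brownian_motion (R : realType) (dd : measure_display)
    (Omega : measurableType dd) (P : probability Omega R) (d : nat)
    (W : R -> Omega -> 'rV[R]_d) : Prop :=
  [/\ levy_process P W,
      forall w, {within `[0, +oo[, continuous (fun t => W t w)},
      forall xi t, 0 <= t ->
        ('E_P[fun w => cos (dot xi (W t w - W 0%R w)%R)]
          = (expR (- t * enorm xi ^+ 2))%:E)%E
    & forall xi t, 0 <= t ->
        ('E_P[fun w => sin (dot xi (W t w - W 0%R w)%R)] = 0)%E].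

Definition independent_processes (R : realType) (dd : measure_display)
    (Omega : measurableType dd) (P : probability Omega R)
    (E F : topologicalType) (Y : R -> Omega -> E) (Z : R -> Omega -> F)
    : Prop :=
  independent_events P (generated_events [set t | 0 <= t] Y)
    (generated_events [set t | 0 <= t] Z).

Definition subordinate (R : realType) (Omega E : Type)
    (W : R -> Omega -> E) (S : R -> Omega -> R) (t : R) (w : Omega) : E :=
  W (S t w) w.

(* Expected time spent in A. *)
Definition potential_measure (R : realType) (dd : measure_display)
    (Omega : measurableType dd) (P : probability Omega R) (E : Type)
    (Y : R -> Omega -> E) (A : set E) : \bar R :=
  (\int[P]_w \int[lebesgue_measure]_(t in `[0%R, +oo[) (\1_A (Y t w))%:E)%E.

(* Transience of a Levy process: its potential measure is a Radon measure. *)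
Definition transient (R : realType) (dd : measure_display)
    (Omega : measurableType dd) (P : probability Omega R)
    (E : topologicalType) (Y : R -> Omega -> E) : Prop :=
  forall K : set E, compact K -> (potential_measure P Y K < +oo)%E.

(* u is the completely monotone density of the potential measure of S. *)
Definition potential_density (R : realType) (dd : measure_display)
    (Omega : measurableType dd) (P : probability Omega R)
    (S : R -> Omega -> R) (u : R -> R) : Prop :=
  completely_monotone u /\
  forall A : set R, measurable A -> A `<=` `]0, +oo[ ->
    (potential_measure P S A = \int[lebesgue_measure]_(t in A) (u t)%:E)%E.

(* Integral over t > 0 of the density at distance r from the origin of the
   law of W_t, against the weight m. *)
Definition heat_mixture (R : realType) (d : nat) (m : R -> R) (r : R)
    : \bar R :=
  (\int[lebesgue_measure]_(t in `]0%R, +oo[)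
     ((4 * pi * t) `^ (- (d%:R / 2)) * expR (- (r ^+ 2 / (4 * t))) * m t)%:E)%E.

Definition levy_jump_density (R : realType) (d : nat) (mu : R -> R)
    (x : 'rV[R]_d) : \bar R :=
  heat_mixture d mu (enorm x).

Definition green_function (R : realType) (d : nat) (u : R -> R)
    (x : 'rV[R]_d) : \bar R :=
  heat_mixture d u (enorm x).

(* Main.v *)
Require Import Defs.
From HB Require Import structures.
From mathcomp Require Import all_boot all_order all_algebra.
From mathcomp Require Import all_classical all_reals all_analysis.
From mathcomp Require Import measurable_realfun lra ring.

Set Implicit Arguments.
Unset Strict Implicit.
Unset Printing Implicit Defensive.

Import Order.TTheory GRing.Theory Num.Theory.
Import numFieldNormedType.Exports.

Local Open Scope classical_set_scope.
Local Open Scope ring_scope.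

(** The heat kernel at time t and distance r is r^-d times a profile of
    t / r^2, which decays faster than any power as t / r^2 tends to 0, is at most
    (t / r^2)^(- d/2), and is bounded below on compact subsets of (0, +oo).
    Integrating it against a density m on (0, +oo) therefore measures r^-d times
    the mass of m at times of order r^2, as soon as the short times and the long
    times do not dominate. The two scaling hypotheses on phi, glued at 1 into
    power bounds valid at all scales ([global_scaling]), exclude precisely this.

    For the jump density, the profile is at most a multiple of x / (1 + x), hence
    of the kernel 1 - exp (- x) that defines phi, so that the mixture is at most a
    multiple of r^-d phi(r^-2). Conversely the part of phi(l) due to jumps much
    shorter or much longer than 1/l is small, since phi(k l) is much smaller than
    k phi(l) and phi(l / M) much smaller than phi(l) when k and M are large; so mu
    carries a mass of order phi(l) near 1/l ([levy_mass_at_scale]).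

    For the Green function the role of phi is taken by 1/phi, the Laplace
    transform of the potential measure U of S. Markov's inequality gives
    U([0, a]) <= e / phi(1/a). Cutting the half-line into dyadic shells bounds
    the Green function by r^-d times the sum over j of
    2^(- j d/2) / phi(2^-j r^-2), which the upper scaling compares with a
    geometric series of ratio 2^(be - d/2) < 1 ([green_upper]). For the lower
    bound U, like mu, has its mass near 1/l ([potential_mass_at_scale]).

    Transience rests on the same dyadic sum, through the estimate that
    P(|W_s| < M) is at most of order s^(- d/2). The law of W_s is known by its
    characteristic function, and the estimate follows by taking the mean of a
    Fejer kernel, a finite trigonometric sum, whose mesh is adapted to s
    ([brownian_ball_fejer], [brownian_ball_decay]). To evaluate the Brownian
    motion at the independent time S_t, this time is rounded up to a grid, where
    independence applies to countably many events ([grid_event_prob_le]); the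
    right-continuity of W then removes the grid. *)

(** * The heat kernel in scaled time *)

Section RealInequalities.
Context {R : realType}.
Implicit Types x y t r p q eta M : R.

Lemma expRN_le_inv x : 0 <= x -> expR (- x) <= (1 + x)^-1.
Proof.
move=> x0; rewrite expRN lef_pV2 ?posrE ?expR_gt0 ?expR_ge1Dx//.
by rewrite ltr_pwDl.
Qed.

Lemma min1_le_one_sub_expR x : 0 <= x -> Num.min 1 x <= 2 * (1 - expR (- x)).
Proof.
move=> x0; have := expRN_le_inv x0; set e := expR _ => he.
have h1 : 0 < 1 + x by rewrite ltr_pwDl.
have h2 : e * (1 + x) <= 1 by rewrite -ler_pdivlMr// div1r.
rewrite ge_min; case: (leP 1 x) => x1; apply/orP; [left|right].
  by nra.
have e0 : 0 < e by rewrite expR_gt0.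
nra.
Qed.

Lemma powR_mul_expRN_le q y : 0 < q -> 0 <= y ->
  y `^ q * expR (- (y / 4)) <= (4 * q) `^ q.
Proof.
move=> q0 y0.
have h : y / (4 * q) <= expR (y / (4 * q)).
  by rewrite (le_trans _ (expR_ge1Dx _))// lerDr.
have q4 : 0 < 4 * q by lra.
have -> : y = (4 * q) * (y / (4 * q)) by field; lra.
set z := y / _ in h *.
have z0 : 0 <= z by rewrite divr_ge0// ltW.
have -> : - (4 * q * z / 4) = - (z * q) by field.
rewrite expRN expRM powRM ?(ltW q4)//.
rewrite -mulrA ler_piMr ?powR_ge0// ler_pdivrMr ?powR_gt0 ?expR_gt0// mul1r.
by apply: ge0_ler_powR; rewrite ?nnegrE ?expR_ge0// ltW.
Qed.

(** The heat kernel at time x and distance 1; Brownian scaling expresses every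
    other value of the kernel through it. *)
Definition heat_profile (d : nat) x : R :=
  (4 * pi * x) `^ (- (d%:R / 2)) * expR (- (x^-1 / 4)).

Lemma heat_kernel_scaling (d : nat) r t : 0 < r -> 0 < t ->
  (4 * pi * t) `^ (- (d%:R / 2)) * expR (- (r ^+ 2 / (4 * t))) =
  r ^- d * heat_profile d (t / r ^+ 2).
Proof.
move=> r0 t0; have r20 : 0 < r ^+ 2 by rewrite exprn_gt0.
have pi0 : 0 < pi :> R := pi_gt0 R.
rewrite /heat_profile.
have -> : 4 * pi * t = (4 * pi * (t / r ^+ 2)) * r ^+ 2 by field; lra.
rewrite [LHS]mulrC powRM; last 2 first.
- by rewrite !mulr_ge0// ?pi_ge0// ?invr_ge0 ltW.
- by rewrite ltW.
have -> : (r ^+ 2) `^ (- (d%:R / 2)) = r ^- d.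
  rewrite -powR_mulrn ?ltW// -powRrM mulrN mulrC divfK// powRN powR_mulrn//.
  exact: ltW.
have -> : - (r ^+ 2 / (4 * t)) = - ((t / r ^+ 2)^-1 / 4) by field; lra.
by rewrite mulrC mulrAC mulrC.
Qed.

Lemma heat_profile_ge0 d x : 0 <= heat_profile d x.
Proof. by rewrite mulr_ge0// ?powR_ge0// expR_ge0. Qed.

Lemma heat_profile_le_powR d x : 0 < x -> heat_profile d x <= x `^ (- (d%:R / 2)).
Proof.
move=> x0; have pi2 := pi_ge2 R; rewrite /heat_profile.
rewrite -[leRHS]mulr1 ler_pM ?powR_ge0 ?expR_ge0//; last first.
  by rewrite -expR0 ler_expR oppr_le0 divr_ge0// invr_ge0 ltW.
rewrite !powRN lef_pV2 ?posrE ?powR_gt0//; last nra.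
by apply: ge0_ler_powR; rewrite ?divr_ge0 ?nnegrE//; nra.
Qed.

(** Near time zero the Gaussian factor beats every power of the time. *)
Lemma heat_profile_le_linear d : exists2 C, 1 <= C &
  forall x, 0 < x -> heat_profile d x <= C * Num.min 1 x.
Proof.
set q : R := d%:R / 2 + 1.
have q0 : 0 < q by rewrite /q ltr_wpDl// divr_ge0.
exists (1 + (4 * q) `^ q); first by rewrite lerDl powR_ge0.
move=> x x0; have hx := heat_profile_le_powR d x0.
have c0 := powR_ge0 (4 * q) q.
rewrite /Num.min; case: ltP => x1.
  have : x `^ (- (d%:R / 2)) <= 1.
    rewrite powRN invf_le1 ?powR_gt0// -[leLHS](powRr0 x).
    by apply: ler_powR; [exact: ltW|rewrite divr_ge0].
  by lra.
have x' : 0 <= x^-1 by rewrite invr_ge0 ltW.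
have := powR_mul_expRN_le q0 x'.
rewrite /heat_profile => h.
have : (4 * pi * x) `^ (- (d%:R / 2)) <= x^-1 `^ q * x.
  have -> : x^-1 `^ q * x = x `^ (- (d%:R / 2)).
    rewrite -powR_inv1 ?(ltW x0)// -powRrM -[X in _ * X]powRr1 ?(ltW x0)//.
    rewrite -powRD; first by congr (_ `^ _); rewrite /q; ring.
    by rewrite (gt_eqF x0) implybT.
  rewrite !powRN lef_pV2 ?posrE ?powR_gt0//; last first.
    by have := pi_ge2 R; nra.
  by apply: ge0_ler_powR; rewrite ?divr_ge0 ?nnegrE//; have := pi_ge2 R; nra.
move=> h2; rewrite (le_trans (ler_wpM2r (expR_ge0 _) h2))//.
rewrite mulrAC ler_wpM2r//; first exact: ltW.
by rewrite (le_trans h)// lerDr.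
Qed.

Lemma heat_profile_lower d eta M : 0 < eta -> eta <= M ->
  exists2 c, 0 < c & forall x, eta < x -> x <= M -> c <= heat_profile d x.
Proof.
move=> eta0 etaM; have pi0 := pi_gt0 R.
have M0 : 0 < M by exact: lt_le_trans etaM.
exists ((4 * pi * M) `^ (- (d%:R / 2)) * expR (- (eta^-1 / 4))).
  by rewrite mulr_gt0 ?expR_gt0 ?powR_gt0// !mulr_gt0.
move=> x etax xM; have x0 : 0 < x by exact: lt_trans etax.
rewrite ler_pM ?powR_ge0 ?expR_ge0//; last first.
  by rewrite ler_expR lerN2 ler_pM2r// lef_pV2 ?posrE// ltW.
have p0 : 0 < 4 * pi :> R by rewrite mulr_gt0.
rewrite !powRN lef_pV2 ?posrE ?powR_gt0 ?mulr_gt0//.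
apply: ge0_ler_powR; rewrite ?divr_ge0 ?nnegrE ?(ltW (mulr_gt0 p0 _))//.
by rewrite ler_pM2l.
Qed.

(** Bounds of order x^-p thus become sums over j of 2^(- p j) times the indicator
    of [0, 2^j], whose integral involves only the mass of that interval. *)
Lemma dyadic_shell_bound p x v : 0 < x -> 0 <= p -> v <= 1 -> v <= x `^ (- p) ->
  exists2 j : nat, x <= 2 ^+ j & v <= 2 `^ p * (2 `^ (- p)) ^+ j.
Proof.
move=> x0 p0 v1 vx.
have ex : exists j : nat, x <= 2 ^+ j.
  exists (Num.bound x); rewrite (le_trans (ltW (archi_boundP (ltW x0))))//.
  by rewrite -natrX ler_nat ltnW// ltn_expl.
case: (ex_minnP ex) => -[x1 _|j xj min].
  exists 0%N => //.
  by rewrite expr0 mulr1 (le_trans v1)// -[leLHS](powRr0 2) ler_powR ?ler1n.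
exists j.+1 => //.
have jx : 2 ^+ j < x by rewrite ltNge; apply/negP => /min; rewrite ltnn.
rewrite (le_trans vx)// exprS mulrA -powRD; last by rewrite pnatr_eq0 implybT.
rewrite subrr powRr0 mul1r -powR_mulrn ?powR_ge0// -powRrM mulrC powRrM.
rewrite powR_mulrn// !powRN lef_pV2 ?posrE ?powR_gt0 ?exprn_gt0//.
by apply: ge0_ler_powR; rewrite ?nnegrE ?exprn_ge0// ltW.
Qed.

End RealInequalities.

(** * Power scaling at all scales *)

Section Scaling.
Context {R : realType}.
Implicit Types (phi : R -> R) (e a b l k r s : R).

Lemma powR_neg_small e eps : 0 < e -> 0 < eps ->
  exists2 k : R, 1 <= k & k `^ (- e) <= eps.
Proof.
move=> e0 eps0; have h : 1 <= 1 + eps^-1 by rewrite lerDl invr_ge0 ltW.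
exists ((1 + eps^-1) `^ e^-1).
  by rewrite -[leLHS](powRr0 (1 + eps^-1)) ler_powR// invr_ge0 ltW.
rewrite -powRrM mulrN mulVf ?gt_eqF// powR_inv1 ?(le_trans ler01)//.
have h0 := lt_le_trans ltr01 h.
by rewrite invf_ple ?posrE// lerDr.
Qed.

(** Two power bounds meeting at 1 combine: a ratio straddling 1 is the product
    of a ratio below 1 and one above. *)
Lemma power_lower_glue phi e a b : (forall l, 0 < l -> 0 < phi l) ->
  0 < a -> 0 < b ->
  (forall r s, 1 <= r -> r <= s -> a * (s / r) `^ e <= phi s / phi r) ->
  (forall r s, 0 < r -> r <= s -> s <= 1 -> b * (s / r) `^ e <= phi s / phi r) ->
  exists2 c, 0 < c &
    forall r s, 0 < r -> r <= s -> c * (s / r) `^ e <= phi s / phi r.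
Proof.
move=> phi0 a0 b0 ha hb; have ab0 := mulr_gt0 a0 b0.
exists (Num.min (a * b) (Num.min a b)); first by rewrite !lt_min a0 b0 ab0.
move=> r s r0 rs; have s0 := lt_le_trans r0 rs.
have [r1|r1] := leP 1 r.
  rewrite (le_trans _ (ha _ _ r1 rs))// ler_wpM2r ?powR_ge0//.
  by rewrite !ge_min lexx orbT.
have [s1|s1] := leP s 1.
  rewrite (le_trans _ (hb _ _ r0 rs s1))// ler_wpM2r ?powR_ge0//.
  by rewrite !ge_min lexx !orbT.
have -> : phi s / phi r = phi s / phi 1 * (phi 1 / phi r).
  by rewrite mulrA divfK// gt_eqF// phi0.
have -> : s / r = s / 1 * (1 / r) by field; lra.
rewrite powRM ?divr_ge0// ?(ltW s0) ?(ltW r0)//.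
apply: (@le_trans _ _ ((a * (s / 1) `^ e) * (b * (1 / r) `^ e))); last first.
  rewrite ler_pM ?mulr_ge0 ?powR_ge0 ?(ltW a0) ?(ltW b0)//.
  - by rewrite ha// ltW.
  - by rewrite hb// ltW.
rewrite mulrACA ler_wpM2r ?mulr_ge0 ?powR_ge0//.
by rewrite ge_min lexx.
Qed.

Lemma power_upper_glue phi e a b : (forall l, 0 < l -> 0 < phi l) ->
  0 < a -> 0 < b ->
  (forall r s, 1 <= r -> r <= s -> phi s / phi r <= a * (s / r) `^ e) ->
  (forall r s, 0 < r -> r <= s -> s <= 1 -> phi s / phi r <= b * (s / r) `^ e) ->
  exists2 c, 0 < c &
    forall r s, 0 < r -> r <= s -> phi s / phi r <= c * (s / r) `^ e.
Proof.
move=> phi0 a0 b0 ha hb.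
have inv r s c : 0 < c -> 0 < r -> 0 < s ->
    (phi s / phi r <= c * (s / r) `^ e) =
    (c^-1 * (s / r) `^ (- e) <= (phi s)^-1 / (phi r)^-1).
  move=> c0 r0 s0; rewrite powRN -invfM -[in RHS]invfM lef_pV2//.
  - by rewrite posrE mulr_gt0// powR_gt0// divr_gt0.
  - by rewrite posrE divr_gt0// phi0.
have [|||||c c0 hc] := @power_lower_glue (fun l => (phi l)^-1) (- e) a^-1 b^-1.
- by move=> l l0; rewrite invr_gt0 phi0.
- by rewrite invr_gt0.
- by rewrite invr_gt0.
- move=> r s r1 rs; have r0 := lt_le_trans ltr01 r1.
  by rewrite -inv// ?ha// (lt_le_trans r0).
- move=> r s r0 rs s1.
  by rewrite -inv// ?hb// (lt_le_trans r0).
exists c^-1; first by rewrite invr_gt0.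
move=> r s r0 rs; have s0 := lt_le_trans r0 rs.
by rewrite inv ?invr_gt0// invrK; exact: hc.
Qed.

Definition scales_below phi a e :=
  forall l k, 0 < l -> 1 <= k -> a * k `^ e * phi l <= phi (k * l).

Definition scales_above phi a e :=
  forall l k, 0 < l -> 1 <= k -> phi (k * l) <= a * k `^ e * phi l.

(** The smaller of the two lower exponents and the larger of the two upper
    exponents work at every scale. *)
Lemma global_scaling phi (d1 d2 d3 d4 a1 a2 a3 a4 : R) :
    (forall l, 0 < l -> 0 < phi l) ->
    [/\ 0 < a1, 0 < a2, 0 < a3 & 0 < a4] ->
    (forall r s : R, 1 <= r -> r <= s ->
      a1 * (s / r) `^ d1 <= phi s / phi r /\
      phi s / phi r <= a2 * (s / r) `^ d2) ->
    (forall r s : R, 0 < r -> r <= s -> s <= 1 ->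
      a3 * (s / r) `^ d3 <= phi s / phi r /\
      phi s / phi r <= a4 * (s / r) `^ d4) ->
  exists c1 c2, [/\ 0 < c1, 0 < c2, scales_below phi c1 (Num.min d1 d3) &
    scales_above phi c2 (Num.max d2 d4)].
Proof.
move=> phi0 [a10 a20 a30 a40] hinf hzero.
have ge1 r s : 0 < r -> r <= s -> 1 <= s / r.
  by move=> r0 rs; rewrite ler_pdivlMr// mul1r.
have [||c1 c10 h1] := power_lower_glue phi0 a10 a30 (e := Num.min d1 d3).
- move=> r s r1 rs; have [h _] := hinf r s r1 rs.
  rewrite (le_trans _ h)// ler_wpM2l// ?(ltW a10)// ler_powR//.
    by rewrite ge1// (lt_le_trans ltr01).
  by rewrite ge_min lexx.
- move=> r s r0 rs s1; have [h _] := hzero r s r0 rs s1.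
  rewrite (le_trans _ h)// ler_wpM2l// ?(ltW a30)// ler_powR//.
    by rewrite ge1.
  by rewrite ge_min lexx orbT.
have [||c2 c20 h2] := power_upper_glue phi0 a20 a40 (e := Num.max d2 d4).
- move=> r s r1 rs; have [_ h] := hinf r s r1 rs.
  rewrite (le_trans h)// ler_wpM2l// ?(ltW a20)// ler_powR//.
    by rewrite ge1// (lt_le_trans ltr01).
  by rewrite le_max lexx.
- move=> r s r0 rs s1; have [_ h] := hzero r s r0 rs s1.
  rewrite (le_trans h)// ler_wpM2l// ?(ltW a40)// ler_powR//.
    by rewrite ge1.
  by rewrite le_max lexx orbT.
have scaled l k : 0 < l -> 1 <= k -> l <= k * l.
  by move=> l0 k1; rewrite ler_peMl// ltW.
exists c1, c2; split => // l k l0 k1.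
- have := h1 _ _ l0 (scaled _ _ l0 k1).
  by rewrite mulfK ?gt_eqF// ler_pdivlMr ?phi0.
- have := h2 _ _ l0 (scaled _ _ l0 k1).
  by rewrite mulfK ?gt_eqF// ler_pdivrMr ?phi0.
Qed.

End Scaling.

(** * Integrals of nonnegative functions *)

Section Integrals.
Local Open Scope ereal_scope.

(** The integral of a nonnegative function is a supremum over the simple
    functions below it, hence monotone also on non-measurable functions. *)
Lemma ge0_le_integral_subset (dd : measure_display) (T : measurableType dd)
    (R : realType) (m : {measure set T -> \bar R}) (A D : set T)
    (f g : T -> \bar R) :
  A `<=` D -> (forall x, A x -> 0 <= f x) -> (forall x, D x -> 0 <= g x) ->
  (forall x, A x -> f x <= g x) ->
  \int[m]_(x in A) f x <= \int[m]_(x in D) g x.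
Proof.
move=> AD f0 g0 fg.
rewrite (integral_mkcond A) (integral_mkcond D).
have fA0 x : 0 <= (f \_ A) x by exact: erestrict_ge0.
have gD0 x : 0 <= (g \_ D) x by exact: erestrict_ge0.
rewrite !ge0_integralTE//; apply: le_ereal_sup => _ [h hf <-]; exists h => //= x.
rewrite (le_trans (hf x))// /patch; case: ifPn => [/set_mem Ax|_]; last exact: gD0.
by rewrite ifT; [exact: fg|rewrite inE; exact: AD].
Qed.

Lemma geometric_eseries_le (R : realType) (c q : R) (u : nat -> \bar R) :
  (0 <= c)%R -> (0 <= q < 1)%R -> (forall n, 0 <= u n) ->
  (forall n, u n <= (c * q ^+ n)%:E) ->
  \sum_(n <oo) u n <= (c / (1 - q))%:E.
Proof.
move=> c0 /andP[q0 q1] u0 uq.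
apply: (@le_trans _ _ (\sum_(n <oo) (c * q ^+ n)%:E)); first exact: lee_nneseries.
rewrite le_eqVlt; apply/orP; left; apply/eqP/cvg_lim => //.
rewrite [X in X @ _](_ : _ = EFin \o series (geometric c q)); last first.
  by apply/funext => n /=; rewrite /series/= sumEFin.
by apply: cvg_EFin; [exact: nearW|apply: cvg_geometric_series; rewrite ger0_norm].
Qed.

End Integrals.

(** * Separation of scales *)

Section ScaleSeparation.
Context {R : realType}.
Implicit Types (phi : R -> R) (e c l k : R).

Lemma scales_below_small phi c e eps : (forall l, 0 < l -> 0 < phi l) ->
  0 < c -> 0 < e -> scales_below phi c e -> 0 < eps ->
  exists2 k, 1 <= k & forall l, 0 < l -> phi l <= eps * phi (k * l).
Proof.
move=> phi0 c0 e0 hphi eps0.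
have [k k1 hk] := powR_neg_small e0 (mulr_gt0 c0 eps0).
have k0 : 0 < k := lt_le_trans ltr01 k1.
exists k => // l l0; have := hphi _ _ l0 k1.
have kl0 : 0 < phi (k * l) by rewrite phi0// mulr_gt0.
have := phi0 _ l0; set a := phi l; set b := phi (k * l) in kl0 *.
move=> a0 h; move: hk; rewrite powRN => hk.
have ke0 : 0 < k `^ e by rewrite powR_gt0.
have : 1 <= c * eps * k `^ e by rewrite -ler_pdivrMr// div1r.
move: h; set z := k `^ e in ke0 *; move=> h h1.
have : a * (c * z) <= b by rewrite mulrC.
rewrite -ler_pdivlMr ?mulr_gt0// => /le_trans; apply.
rewrite mulrC ler_wpM2r ?(ltW kl0)// -[leLHS]mul1r ler_pdivrMr ?mulr_gt0//.
by rewrite mulrCA mulrA.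
Qed.

Lemma scales_above_small phi c e eps : (forall l, 0 < l -> 0 < phi l) ->
  0 < c -> e < 1 -> scales_above phi c e -> 0 < eps ->
  exists2 k, 1 <= k & forall l, 0 < l -> phi (k * l) <= eps * k * phi l.
Proof.
move=> phi0 c0 e1 hphi eps0.
have e1' : 0 < 1 - e by rewrite subr_gt0.
have [k k1 hk] := powR_neg_small e1' (divr_gt0 eps0 c0).
have k0 : 0 < k := lt_le_trans ltr01 k1.
exists k => // l l0; rewrite (le_trans (hphi _ _ l0 k1))//.
rewrite ler_wpM2r ?(ltW (phi0 _ l0))//.
have -> : k `^ e = k `^ (- (1 - e)) * k.
  rewrite -[X in _ * X]powRr1 ?(ltW k0)// -powRD.
    by congr (_ `^ _); ring.
  by rewrite (gt_eqF k0) implybT.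
by rewrite mulrA ler_wpM2r ?(ltW k0)// mulrC -ler_pdivlMr.
Qed.

Lemma scales_above_dyadic phi c e l j : (forall l, 0 < l -> 0 < phi l) ->
  scales_above phi c e -> 0 < l ->
  (phi ((2 ^+ j)^-1 * l))^-1 <= c * (2 `^ e) ^+ j / phi l.
Proof.
move=> phi0 ha l0; have h2 : 0 < 2 ^+ j :> R by rewrite exprn_gt0.
have l'0 : 0 < (2 ^+ j)^-1 * l by rewrite mulr_gt0// invr_gt0.
have h21 : 1 <= 2 ^+ j :> R by rewrite exprn_ege1// ler1n.
have := ha _ _ l'0 h21; rewrite mulVKf ?gt_eqF//.
have -> : (2 ^+ j) `^ e = (2 `^ e) ^+ j.
  by rewrite -(powR_mulrn j (ler0n R 2)) -(powR_mulrn j (powR_ge0 2 e)) -!powRrM mulrC.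
have p0 := phi0 _ l0; have p'0 := phi0 _ l'0.
by move=> h; rewrite ler_pdivlMr// mulrC ler_pdivrMr.
Qed.

(** The dimension condition makes the dyadic sums geometric. *)
Lemma dyadic_ratio (d : nat) e : 2 * e < d%:R ->
  0 <= (2 `^ e * 2 `^ (- (d%:R / 2)) : R) < 1.
Proof.
move=> ed; rewrite mulr_ge0 ?powR_ge0//=.
rewrite -powRD; last by rewrite pnatr_eq0 implybT.
rewrite /powR pnatr_eq0/= -[ltRHS]expR0 ltr_expR pmulr_llt0 ?ln_gt0 ?ltr1n//.
by rewrite subr_lt0; lra.
Qed.

End ScaleSeparation.

(** * The jump density *)

Section LevyDensity.
Context {R : realType}.
Implicit Types (phi mu m : R -> R) (r t x : R).

Notation halfline := (`]0%R, +oo[%classic : set R).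

Lemma halflineP t : halfline t <-> 0 < t.
Proof. by rewrite /= in_itv/= andbT. Qed.

Lemma completely_monotone_ge0 m t : completely_monotone m -> 0 < t -> 0 <= m t.
Proof. by move=> /(_ 0%N t) h /h[_]; rewrite expr0 mul1r. Qed.

Lemma completely_monotone_measurable m :
  completely_monotone m -> measurable_fun halfline m.
Proof.
move=> cm; apply: open_continuous_measurable_fun.
  exact: interval_open.
move=> t; rewrite inE => /halflineP t0; have [dm _] := cm 0%N t t0.
by apply: differentiable_continuous; apply/derivable1_diffP.
Qed.

Lemma heat_mixture_le d m (g : R -> R) C r : 0 < r -> 0 <= C ->
  (forall t, 0 < t -> 0 <= m t) -> (forall x, 0 < x -> 0 <= g x) ->
  measurable_fun halfline (fun t => g (t / r ^+ 2) * m t) ->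
  (forall x, 0 < x -> heat_profile d x <= C * g x) ->
  (heat_mixture d m r <= (C * r ^- d)%:E *
    \int[lebesgue_measure]_(t in halfline) (g (t / r ^+ 2) * m t)%:E)%E.
Proof.
move=> r0 C0 m0 g0 mg hg; have r20 : 0 < r ^+ 2 by rewrite exprn_gt0.
have rd0 : 0 <= r ^- d by rewrite invr_ge0 exprn_ge0// ltW.
rewrite -ge0_integralZl//; last 3 first.
- exact/measurable_EFinP.
- by move=> t /halflineP t0; rewrite lee_fin mulr_ge0 ?g0 ?m0// divr_gt0.
- by rewrite lee_fin mulr_ge0.
apply: ge0_le_integral_subset => // t /halflineP t0; rewrite lee_fin.
- by rewrite !mulr_ge0 ?powR_ge0 ?expR_ge0 ?m0.
- by rewrite !mulr_ge0 ?g0 ?m0// divr_gt0.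
rewrite heat_kernel_scaling// [leRHS]mulrA ler_wpM2r ?m0//.
by rewrite (mulrC C) -mulrA ler_wpM2l// hg// divr_gt0.
Qed.

Lemma heat_mixture_ge d (eta M : R) : 0 < eta -> eta <= M ->
  exists2 c, 0 < c & forall m r, 0 < r -> (forall t, 0 < t -> 0 <= m t) ->
  measurable_fun halfline m ->
  ((c * r ^- d)%:E * \int[lebesgue_measure]_(t in
     `](eta * r ^+ 2)%R, (M * r ^+ 2)%R]) (m t)%:E <= heat_mixture d m r)%E.
Proof.
move=> eta0 etaM; have [c c0 hc] := heat_profile_lower d eta0 etaM.
exists c => // m r r0 m0 mm; have r20 : 0 < r ^+ 2 by rewrite exprn_gt0.
have rd0 : 0 <= r ^- d by rewrite invr_ge0 exprn_ge0// ltW.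
have pos t : t \in `](eta * r ^+ 2)%R, (M * r ^+ 2)%R] -> 0 < t.
  by rewrite in_itv/= => /andP[h _]; apply: lt_trans h; rewrite mulr_gt0.
rewrite -ge0_integralZl//; last 3 first.
- apply/measurable_EFinP; apply: measurable_funS mm => //.
  by move=> t /pos t0; apply/halflineP.
- by move=> t /pos t0; rewrite lee_fin m0.
- by rewrite lee_fin mulr_ge0// ltW.
apply: ge0_le_integral_subset => [t /pos|t /pos t0|t /halflineP t0|t /[dup] /pos t0].
- by move/halflineP.
- by rewrite lee_fin !mulr_ge0 ?m0// ltW.
- by rewrite lee_fin !mulr_ge0 ?powR_ge0 ?expR_ge0 ?m0.
rewrite /= in_itv/= => /andP[h1 h2].
rewrite lee_fin heat_kernel_scaling// ler_wpM2r ?m0//.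
rewrite mulrC ler_wpM2l// hc//; first by rewrite ltr_pdivlMr.
by rewrite ler_pdivrMr.
Qed.

(** A jump of length s < 1 / (k l) contributes at most l s to phi l, that is, at
    most 2/k times what it contributes to phi (k l), and phi (k l) is much smaller
    than k phi l. A jump longer than M / l contributes at most twice as much to
    phi l as to phi (l / M), which is a small part of phi l. The jumps in between
    carry the rest. *)
Lemma levy_mass_at_scale phi mu c1 c2 al be : complete_bernstein phi mu ->
  0 < c1 -> 0 < c2 -> 0 < al -> be < 1 ->
  scales_below phi c1 al -> scales_above phi c2 be ->
  exists eta M, [/\ 0 < eta, eta <= M & forall l, 0 < l ->
    ((phi l / 2)%:E <=
     \int[lebesgue_measure]_(t in `](eta / l)%R, (M / l)%R]) (mu t)%:E)%E].
Proof.
move=> [phi0 cm _ hphi] c10 c20 al0 be1 hb ha.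
(* Each of the two error terms carries a factor 2 and may take a quarter of
   phi l. *)
have e8 : 0 < 8^-1 :> R by rewrite invr_gt0.
have [k k1 hk] := scales_above_small phi0 c20 be1 ha e8.
have [M M1 hM] := scales_below_small phi0 c10 al0 hb e8.
have k0 : 0 < k := lt_le_trans ltr01 k1.
have M0 : 0 < M := lt_le_trans ltr01 M1.
exists k^-1, M; split; first by rewrite invr_gt0.
  by rewrite (le_trans _ M1)// invf_le1.
move=> l l0.
have mu0 t : 0 < t -> 0 <= mu t by exact: completely_monotone_ge0.
have mmu := completely_monotone_measurable cm.
pose A : set R := `](k^-1 / l)%R, (M / l)%R]%classic.
pose F (a t : R) := ((1 - expR (- a * t)) * mu t).
have F0 a t : 0 < a -> 0 < t -> 0 <= F a t.
  move=> a0 t0; rewrite mulr_ge0 ?mu0// subr_ge0 -expR0 ler_expR mulNr oppr_le0.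
  by rewrite mulr_ge0// ltW.
have mF a : measurable_fun halfline (EFin \o F a).
  apply/measurable_EFinP; apply: measurable_funM => //.
  apply: measurable_funB => //; apply: measurableT_comp => //.
have mA : measurable A by exact: measurable_itv.
have mAmu : measurable_fun halfline ((EFin \o mu) \_ A).
  apply: (measurable_restrict _ _ _).1 => //.
  apply/measurable_EFinP; apply: measurable_funS mmu => //.
have kl0 : 0 < k * l by exact: mulr_gt0.
have lM0 : 0 < l / M by exact: divr_gt0.
have k'0 : 0 <= 2 * k^-1 by rewrite mulr_ge0// invr_ge0 ltW.
have bound : (\int[lebesgue_measure]_(t in halfline) (F l t)%:E <=
    \int[lebesgue_measure]_(t in halfline) (((EFin \o mu) \_ A) t +
      ((2 * k^-1)%:E * (F (k * l) t)%:E + 2%:E * (F (l / M) t)%:E)))%E.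
  have A0 t : (0 <= ((EFin \o mu) \_ A) t)%E.
    apply: erestrict_ge0 => x; rewrite /A /= in_itv/= => /andP[hx _].
    by rewrite lee_fin mu0// (lt_trans _ hx)// divr_gt0// invr_gt0.
  apply: ge0_le_integral_subset => // t /halflineP t0.
  - by rewrite lee_fin F0.
  - by rewrite adde_ge0// adde_ge0// mule_ge0 ?lee_fin ?F0.
  have G1 := mulr_ge0 k'0 (F0 _ _ kl0 t0).
  have G2 := mulr_ge0 (ler0n R 2) (F0 _ _ lM0 t0).
  rewrite /patch; case: ifPn => [_|]; rewrite /= -!EFinM -!EFinD lee_fin.
    rewrite (ler_wpDr (addr_ge0 G1 G2))//.
    by rewrite /F ler_piMl ?mu0// gerBl expR_ge0.
  rewrite notin_setE /A /= in_itv/= => /negP; rewrite negb_and -leNgt -ltNge.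
  rewrite add0r => /orP[h|h].
  - rewrite (ler_wpDr G2)// /F mulrA ler_wpM2r ?mu0//.
    have y0 : 0 <= k * l * t by rewrite !mulr_ge0// ltW.
    have := min1_le_one_sub_expR y0; rewrite min_r; last first.
      move: h; rewrite ler_pdivlMr// mulrC => h.
      by rewrite -mulrA -ler_pdivlMl// mulr1.
    rewrite -mulNr => h2; rewrite mulrAC -ler_pdivrMr ?invr_gt0// invrK.
    have lt0 : 0 <= l * t by rewrite mulr_ge0// ltW.
    have := expR_ge1Dx (- l * t); set z := expR (- l * t) => hz.
    rewrite (le_trans _ h2)// mulrC -mulrA ler_wpM2l ?(ltW k0)//.
    by move: hz; rewrite mulNr; lra.
  - rewrite (ler_wpDl G1)// /F mulrA ler_wpM2r ?mu0//.
    have y0 : 0 <= l / M * t by rewrite !mulr_ge0 ?invr_ge0// ltW.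
    have := min1_le_one_sub_expR y0; rewrite min_l; last first.
      move: h; rewrite ltr_pdivrMr// => h.
      by rewrite mulrAC ler_pdivlMr// mul1r mulrC ltW.
    rewrite -mulNr => h2; apply: le_trans h2.
    by rewrite gerBl expR_ge0.
move: bound; rewrite -hphi// ge0_integralD//=; last 3 first.
- move=> t _; apply: erestrict_ge0 => x; rewrite /A /= in_itv/= => /andP[hx _].
  by rewrite lee_fin mu0// (lt_trans _ hx)// divr_gt0// invr_gt0.
- by move=> t /halflineP t0; rewrite adde_ge0// mule_ge0 ?lee_fin ?F0.
- by apply: emeasurable_funD; apply: measurable_funeM; exact: mF.
rewrite ge0_integralD//=; last 4 first.
- by move=> t /halflineP t0; rewrite mule_ge0 ?lee_fin ?F0.
- by apply: measurable_funeM; exact: mF.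
- by move=> t /halflineP t0; rewrite mule_ge0 ?lee_fin ?F0.
- by apply: measurable_funeM; exact: mF.
rewrite !ge0_integralZl//=; last 4 first.
- exact: mF.
- by move=> t /halflineP t0; rewrite lee_fin F0.
- exact: mF.
- by move=> t /halflineP t0; rewrite lee_fin F0.
rewrite -!hphi//.
rewrite -integral_mkcondr (_ : halfline `&` A = A); last first.
  apply/setIidr => t; rewrite /A /= !in_itv/= andbT => /andP[h _].
  by apply: lt_trans h; rewrite divr_gt0// invr_gt0.
set X := (\int[_]_(_ in _) _)%E; move=> bound.
have b1 : 2 * k^-1 * phi (k * l) <= phi l / 4.
  have -> : 2 * k^-1 * phi (k * l) = phi (k * l) / (k / 2).
    by field; rewrite gt_eqF.
  rewrite ler_pdivrMr ?divr_gt0//; have := hk _ l0; lra.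
have b2 : 2 * phi (l / M) <= phi l / 4.
  have := hM _ (divr_gt0 l0 M0).
  have -> : M * (l / M) = l by field; rewrite gt_eqF.
  by lra.
rewrite (_ : (phi l / 2)%:E = (phi l)%:E - (phi l / 2)%:E)%E; last first.
  by rewrite -EFinB; congr EFin; lra.
rewrite leeBlDr//; apply: (le_trans bound); rewrite leeD2l//.
by rewrite -!EFinM -EFinD lee_fin; lra.
Qed.

End LevyDensity.

(** Up to the factor r^-d, a short time t enters the jump density with a weight
    of order at most t / r^2 and a long one with a bounded weight; both are
    dominated by the kernel 1 - exp (- t / r^2) of phi at r^-2. The times of order
    r^2 alone give the lower bound. *)
Lemma levy_jump_density_comparable (R : realType) (d : nat) (phi mu : R -> R)
    (c1 c2 al be : R) : complete_bernstein phi mu ->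
  0 < c1 -> 0 < c2 -> 0 < al -> be < 1 ->
  scales_below phi c1 al -> scales_above phi c2 be ->
  exists2 c, 1 <= c & forall r, 0 < r ->
    ((c^-1 * (r ^- d * phi (r ^- 2)))%:E <= heat_mixture d mu r <=
     (c * (r ^- d * phi (r ^- 2)))%:E)%E.
Proof.
move=> hcb c10 c20 al0 be1 hb ha; have [phi0 cm _ hphi] := hcb.
have [eta [M [eta0 etaM hmass]]] := levy_mass_at_scale hcb c10 c20 al0 be1 hb ha.
have [c c0 hc] := heat_mixture_ge d eta0 etaM.
have [C C1 hC] := @heat_profile_le_linear R d.
have C0 : 0 < C by exact: lt_le_trans C1.
have mu0 t : 0 < t -> 0 <= mu t by exact: completely_monotone_ge0.
have mmu := completely_monotone_measurable cm.
exists (2 * C + 2 / c); first by rewrite ler_wpDr ?divr_ge0//; lra.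
move=> r r0; have r20 : 0 < r ^- 2 by rewrite invr_gt0 exprn_gt0.
have p0 := phi0 _ r20.
have rd0 : 0 < r ^- d by rewrite invr_gt0 exprn_gt0.
have c'0 : 0 < 2 / c by rewrite divr_gt0.
apply/andP; split.
- apply: le_trans (hc mu r r0 mu0 mmu).
  have := hmass _ r20; rewrite !invrK => h.
  apply: (@le_trans _ _ ((c * r ^- d)%:E * (phi (r ^- 2) / 2)%:E)%E); last first.
    by rewrite lee_wpmul2l// lee_fin mulr_ge0 ?(ltW c0)// ltW.
  rewrite -EFinM lee_fin.
  have -> : c * r ^- d * (phi (r ^- 2) / 2) = (2 / c)^-1 * (r ^- d * phi (r ^- 2)).
    by rewrite invf_div; move: (r ^- d) (phi _) => x y; field.
  rewrite ler_wpM2r ?mulr_ge0 ?(ltW rd0) ?(ltW p0)//.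
  by rewrite lef_pV2 ?posrE//; lra.
- have := @heat_mixture_le R d mu (fun x => 1 - expR (- x)) (2 * C) r r0.
  move=> /(_ _ mu0) h; apply: (le_trans (h _ _ _ _)).
  + by rewrite mulr_ge0// ltW.
  + move=> x x0; rewrite subr_ge0 -expR0 ler_expR oppr_le0 ltW//.
  + apply: measurable_funM => //; apply: measurable_funB => //.
    apply: measurableT_comp => //; apply: measurableT_comp => //.
    exact: measurable_funM.
  + move=> x x0; rewrite (le_trans (hC _ x0))// -mulrA mulrCA.
    by rewrite ler_wpM2l ?(ltW C0)// min1_le_one_sub_expR// ltW.
  + under eq_integral do rewrite (mulrC _ (r ^- 2)) -mulNr.
    rewrite -hphi// -EFinM lee_fin -[leLHS]mulrA.
    rewrite ler_wpM2r//; first by rewrite mulr_ge0// ltW.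
    by rewrite lerDl ltW.
Qed.

(** * Tonelli on the half-line *)

Section Potential.
Local Open Scope ereal_scope.
Context {R : realType} {dd : measure_display} {Omega : measurableType dd}
  (P : probability Omega R).

Notation halfline0 := (`[0%R, +oo[%classic : set R).

Lemma halfline0P (t : R) : halfline0 t <-> (0 <= t)%R.
Proof. by rewrite /= in_itv/= andbT. Qed.

Lemma integral_expRN (c : R) : (0 < c)%R ->
  \int[lebesgue_measure]_(t in halfline0) (expR (- t * c))%:E = (c^-1)%:E.
Proof.
move=> c0; have := integral_exponential_pdf c0.
have -> : \int[lebesgue_measure]_x (exponential_pdf c x)%:E =
    \int[lebesgue_measure]_(t in halfline0) (c%:E * (expR (- t * c))%:E).
  rewrite [RHS]integral_mkcond; apply: eq_integral => x _.
  rewrite /exponential_pdf /patch; case: ifPn => // _.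
  by rewrite -EFinM !mulNr (mulrC c x).
rewrite ge0_integralZl//; last 2 first.
- apply/measurable_EFinP; apply: measurableT_comp => //.
  by apply: measurable_funM => //; exact: measurableT_comp.
- by rewrite lee_fin ltW.
set X := \int[_]_(_ in _) _ => h.
have : (c^-1)%:E * (c%:E * X) = (c^-1)%:E by rewrite h mule1.
by rewrite muleA -EFinM mulVf ?gt_eqF// mul1e.
Qed.

Lemma tonelli_halfline0 (E : set (Omega * R)) : measurable E ->
  \int[P]_w \int[lebesgue_measure]_(t in halfline0) (\1_E (w, t))%:E =
  \int[lebesgue_measure]_(t in halfline0) P (ysection E t).
Proof.
move=> mE; pose H : set (Omega * R) := setT `*` halfline0.
have mEH : measurable (E `&` H).
  by apply: measurableI => //; apply: measurableX.
have := indic_fubini_tonelli P lebesgue_measure mEH.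
rewrite /fubini_F /= => h.
transitivity (\int[P]_x \int[lebesgue_measure]_y (\1_(E `&` H) (x, y))%:E).
  apply: eq_integral => w _; rewrite integral_mkcond; apply: eq_integral => t _.
  rewrite /patch !indicE in_setI; have -> : ((w, t) \in H) = (t \in halfline0).
    by apply/idP/idP => /set_mem Ht; apply: mem_set => //; case: Ht.
  by case: ifPn; rewrite ?andbT ?andbF.
rewrite h [RHS]integral_mkcond; apply: eq_integral => t _.
rewrite indic_fubini_tonelli_GE//= /patch; case: ifPn => [/set_mem h0|/negP h0].
  by congr (P _); apply/seteqP; split => w; rewrite /ysection /= !inE //; case.
rewrite /point/=; apply: (etrans _ (measure0 P)); congr (P _).
apply/seteqP; split => w //.
rewrite /ysection /= inE => -[_ [_ /= ht]]; exfalso; exact/h0/mem_set.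
Qed.

End Potential.

(** * Measurability of Levy processes *)

Section LevyMeasurability.
Context {R : realType} {dd : measure_display} {Omega : measurableType dd}
  (P : probability Omega R).

Lemma levy_preimage_measurable (E : normedModType R) (Y : R -> Omega -> E) t B :
  levy_process P Y -> 0 <= t -> open B -> measurable (Y t @^-1` B).
Proof. by move=> [mY _] t0 oB; apply: mY => //; exact: sub_gen_smallest. Qed.

Lemma levy_measurable_comp (E : normedModType R) (Y : R -> Omega -> E) t
    (g : E -> R) : levy_process P Y -> 0 <= t -> continuous g ->
  measurable_fun setT (fun w => g (Y t w)).
Proof.
move=> lY t0 cg; apply: (measurability _ (RGenOpens.measurableE R)).
move=> _ [_ [a [b ->] <-]]; rewrite setTI.
apply: (levy_preimage_measurable (B := g @^-1` `]a, b[) lY t0).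
by move/continuousP : cg; apply; exact: interval_open.
Qed.

End LevyMeasurability.

(** * Subordinators *)

Section Subordinator.
Context {R : realType} {dd : measure_display} {Omega : measurableType dd}.
Variables (P : probability Omega R) (phi : R -> R) (S : R -> Omega -> R).
Hypothesis subS : subordinator P phi S.

Lemma subordinator_levy : levy_process P S. Proof. by case: subS. Qed.

Lemma subordinator_nondecreasing w s t : 0 <= s -> s <= t -> S s w <= S t w.
Proof. by case: subS => _ h _; exact: h. Qed.

Lemma subordinator_ge0 w t : 0 <= t -> 0 <= S t w.
Proof.
move=> t0; have [_ [h _ _ _ _]] := subordinator_levy.
by rewrite -(h w) subordinator_nondecreasing.
Qed.

Lemma subordinator_measurable t : 0 <= t -> measurable_fun setT (S t).
Proof.
move=> t0.
have cid : continuous (@id R) by move=> x; exact: cvg_id.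
exact: levy_measurable_comp subordinator_levy t0 cid.
Qed.

Lemma subordinator_laplace l t : 0 < l -> 0 <= t ->
  (\int[P]_w (expR (- l * S t w))%:E = (expR (- t * phi l))%:E)%E.
Proof. by move=> l0 t0; case: subS => _ _ /(_ l t l0 t0); rewrite unlock. Qed.

(** Right-continuity and monotonicity give that S_t < a exactly when S_q < a
    for some rational q > t, so that sublevel sets are countable unions of
    rectangles. *)
Lemma subordinator_jointly_measurable :
  measurable_fun setT (fun z : Omega * R => S (Num.max z.2 0) z.1).
Proof.
apply: (measurability _ (RGenCInfty.measurableE R)) => _ [_ [a ->] <-].
rewrite setTI -[X in measurable X]setCK; apply: measurableC.
pose F (q : rat) : set (Omega * R) :=
  if 0 < q then (S (ratr q) @^-1` `]-oo, a[) `*` `]-oo, (ratr q)[ else set0.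
rewrite (_ : ~` _ = \bigcup_q F q); last first.
  apply/seteqP; split => [[w t]|[w t] [q _]] /=.
    rewrite in_itv/= andbT => /negP; rewrite -ltNge => Sa.
    set t' := Num.max t 0 in Sa *.
    have t'0 : 0 <= t' by rewrite le_max lexx orbT.
    have [_ [_ _ _ rc _]] := subordinator_levy.
    have : \forall r \near t'^'+, S r w < a.
      by have := rc w t' t'0; move/cvgr_lt; apply.
    case=> e /= e0 he.
    have := @rat_in_itvoo R t' (t' + e); rewrite ltrDl => /(_ e0)[q].
    rewrite in_itv/= => /andP[tq qe]; exists q => //; rewrite /F.
    have q0 : 0 < q by rewrite -(ltr0q R) (le_lt_trans t'0).
    rewrite q0; split; rewrite /= in_itv/=.
      apply: he => //=; rewrite ltr0_norm ?subr_lt0// opprB.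
      by rewrite ltrBlDl.
    by rewrite (le_lt_trans _ tq)// le_max lexx.
  rewrite /F; case: ifPn => // q0 [] /=; rewrite !in_itv/= andbT => Sq tq.
  apply/negP; rewrite -ltNge (le_lt_trans _ Sq)//.
  apply: subordinator_nondecreasing; first by rewrite le_max lexx orbT.
  by rewrite ge_max (ltW tq) ler0q ltW.
apply: bigcupT_measurable_rat => q; rewrite /F; case: ifPn => // q0.
apply: measurableX => //; rewrite -[X in measurable X]setTI.
by apply: subordinator_measurable => //; rewrite ler0q ltW.
Qed.

Lemma subordinator_event_jointly_measurable (A : set R) : measurable A ->
  measurable [set z : Omega * R | A (S (Num.max z.2 0) z.1)].
Proof.
by move=> mA; have := subordinator_jointly_measurable measurableT mA; rewrite setTI.
Qed.

Lemma potential_measure_tonelli (A : set R) : measurable A ->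
  (potential_measure P S A =
   \int[lebesgue_measure]_(t in `[0%R, +oo[) P (S t @^-1` A))%E.
Proof.
move=> mA; have mE := subordinator_event_jointly_measurable mA.
rewrite /potential_measure.
transitivity (\int[P]_w \int[lebesgue_measure]_(t in `[0%R, +oo[)
    (\1_[set z : Omega * R | A (S (Num.max z.2 0) z.1)] (w, t))%:E)%E.
  apply: eq_integral => w _; apply: eq_integral => t /set_mem /halfline0P t0.
  rewrite !indicE (_ : (_ \in A) = ((w, t) \in [set z : Omega * R |
    A (S (Num.max z.2 0) z.1)]))//.
  by apply/idP/idP => /set_mem SA; apply: mem_set; move: SA; rewrite /= max_l.
rewrite tonelli_halfline0//; apply: eq_integral => t /set_mem /halfline0P t0.
congr (P _); apply/seteqP; split => w; rewrite /ysection /= inE /= max_l//.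
Qed.

Lemma measurable_subordinator_prob (A : set R) : measurable A ->
  measurable_fun (`[0%R, +oo[%classic : set R) (fun t => P (S t @^-1` A)).
Proof.
move=> mA; have mE := subordinator_event_jointly_measurable mA.
have := measurable_fun_ysection P mE => /= h.
apply: (eq_measurable_fun _ _ (measurable_funTS h)) => t /set_mem /halfline0P t0.
rewrite /=; congr (P _); apply/seteqP; split => w; rewrite /ysection /= inE /= max_l//.
Qed.

(** Markov's inequality for exp (- S t / a). *)
Lemma subordinator_prob_le (A : set R) a t : measurable A ->
  (forall s, A s -> s <= a) -> 0 < a -> 0 <= t ->
  (P (S t @^-1` A) <= (expR 1 * expR (- t * phi a^-1))%:E)%E.
Proof.
move=> mA hA a0 t0; have ai0 : 0 < a^-1 by rewrite invr_gt0.
have mSA : measurable (S t @^-1` A).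
  by have := subordinator_measurable t0 measurableT mA; rewrite setTI.
rewrite EFinM -(subordinator_laplace ai0 t0) -ge0_integralZl//; last first.
  apply/measurable_EFinP; apply: measurableT_comp => //.
  by apply: measurable_funM => //; exact: subordinator_measurable.
rewrite -[X in P X]setIT -integral_indic//.
apply: ge0_le_integral_subset => // w _; rewrite -?EFinM lee_fin ?mulr_ge0 ?expR_ge0//.
rewrite -expRD indicE.
case: (boolP (w \in _)) => [/set_mem /= Aw|_]; last exact: expR_ge0.
rewrite /= -[leLHS]expR0 ler_expR mulNr subr_ge0 mulrC ler_pdivrMr// mul1r.
exact: hA.
Qed.

End Subordinator.

(** * The potential measure and the Green function *)

Section PotentialDensity.
Context {R : realType} {dd : measure_display} {Omega : measurableType dd}.
Variables (P : probability Omega R) (phi : R -> R) (S : R -> Omega -> R).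
Hypothesis subS : subordinator P phi S.
Hypothesis phi_gt0 : forall l, 0 < l -> 0 < phi l.

Lemma potential_measure_le (A : set R) a : measurable A ->
  (forall s, A s -> s <= a) -> 0 < a ->
  (potential_measure P S A <= (expR 1 / phi a^-1)%:E)%E.
Proof.
move=> mA hA a0; have p0 : 0 < phi a^-1 by rewrite phi_gt0// invr_gt0.
rewrite (potential_measure_tonelli subS)// EFinM -integral_expRN//.
rewrite -ge0_integralZl//; last first.
  apply/measurable_EFinP; apply: measurableT_comp => //.
  by apply: measurable_funM => //; exact: measurableT_comp.
apply: ge0_le_integral_subset => // t /halfline0P t0.
rewrite -EFinM; exact: subordinator_prob_le.
Qed.

(** The time S spends below 1 / (k l) is at most e / phi (k l), a small part of
    1 / phi l. The time s beyond M / l enters the Laplace transform 1 / phi l with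
    the weight exp (- l s) <= exp (- M / 2) exp (- l s / 2), hence contributes at
    most exp (- M / 2) / phi (l / 2). The time in between carries the rest. *)
Lemma potential_mass_at_scale c1 c2 al be : 0 < c1 -> 0 < c2 -> 0 < al ->
  scales_below phi c1 al -> scales_above phi c2 be ->
  exists eta M, [/\ 0 < eta, eta <= M & forall l, 0 < l ->
    (((2 * phi l)^-1)%:E <=
      potential_measure P S `](eta / l)%R, (M / l)%R])%E].
Proof.
move=> c10 c20 al0 hb ha.
pose e : R := expR 1; have e0 : 0 < e by exact: expR_gt0.
have e4 : 0 < (4 * e)^-1 by rewrite invr_gt0 mulr_gt0.
have [k k1 hk] := scales_below_small phi_gt0 c10 al0 hb e4.
have k0 : 0 < k := lt_le_trans ltr01 k1.
(* b bounds phi l / phi (l / 2), and M is large enough for exp (- M / 2) b to be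
   at most a quarter. *)
pose b : R := c2 * 2 `^ be; have b0 : 0 < b by rewrite mulr_gt0// powR_gt0.
pose M : R := 1 + 8 * b; have M1 : 1 <= M by rewrite lerDl mulr_ge0// ltW.
have M0 : 0 < M := lt_le_trans ltr01 M1.
exists k^-1, M; split; first by rewrite invr_gt0.
  by rewrite (le_trans _ M1)// invf_le1.
move=> l l0; set A : set R := [set` _].
have mA : measurable A by exact: measurable_itv.
have pl := phi_gt0 l0.
have kl0 : 0 < k * l by exact: mulr_gt0.
have pkl := phi_gt0 kl0.
have l20 : 0 < l / 2 by rewrite divr_gt0.
have pl2 := phi_gt0 l20.
pose e' := expR (- (M / 2)).
have e'0 : 0 < e' by exact: expR_gt0.
have e0E : (0 <= e%:E)%E by rewrite lee_fin ltW.
have e'0E : (0 <= e'%:E)%E by rewrite lee_fin ltW.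
have e'M : e' * b <= 4^-1.
  have M20 : 0 <= M / 2 by rewrite divr_ge0// ltW.
  rewrite (le_trans (ler_wpM2r (ltW b0) (expRN_le_inv M20)))//.
  rewrite mulrC ler_pdivrMr; first by rewrite /M; lra.
  by rewrite ltr_pwDl.
have mS t : 0 <= t -> measurable_fun setT (S t).
  by move=> t0; exact: subordinator_measurable subS _ t0.
have pointwise t : 0 <= t -> ((expR (- t * phi l))%:E <=
    P (S t @^-1` A) + (e%:E * (expR (- t * phi (k * l)))%:E +
      e'%:E * (expR (- t * phi (l / 2)))%:E))%E.
  move=> t0; have mSA : measurable (S t @^-1` A).
    by have := mS t t0 measurableT _ mA; rewrite setTI.
  have mE c : measurable_fun setT (fun w => (expR (- c * S t w))%:E).
    apply/measurable_EFinP; apply: measurableT_comp => //.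
    by apply: measurable_funM => //; exact: mS.
  have lap := subordinator_laplace subS _ t0.
  rewrite -(lap _ l0) -(lap _ kl0) -(lap _ l20).
  rewrite -[X in (P X)]setIT -integral_indic// -!ge0_integralZl//.
  rewrite -ge0_integralD//; last 4 first.
  - by move=> w _; rewrite mule_ge0 ?lee_fin ?expR_ge0.
  - exact: measurable_funeM.
  - by move=> w _; rewrite mule_ge0 ?lee_fin ?expR_ge0.
  - exact: measurable_funeM.
  rewrite -ge0_integralD//; last 3 first.
  - by apply/measurable_EFinP; exact: measurable_indic.
  - by move=> w _; rewrite adde_ge0// mule_ge0 ?lee_fin ?expR_ge0.
  - by apply: emeasurable_funD; exact: measurable_funeM.
  apply: ge0_le_integral_subset => // w _; rewrite -?EFinM -?EFinD lee_fin.
  - by rewrite !addr_ge0 ?mulr_ge0 ?expR_ge0.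
  have S0 := subordinator_ge0 subS w t0; set s := S t w in S0 *.
  have h1 : 0 <= e * expR (- (k * l) * s) by rewrite mulr_ge0 ?expR_ge0.
  have h2 : 0 <= e' * expR (- (l / 2) * s) by rewrite mulr_ge0 ?expR_ge0.
  have le1 : expR (- l * s) <= 1.
    by rewrite -[leRHS]expR0 ler_expR mulNr oppr_le0 mulr_ge0// ltW.
  rewrite indicE; case: (boolP (w \in _)) => [_|].
    by rewrite (le_trans le1)// lerDl addr_ge0.
  rewrite notin_setE /A /= in_itv/= -/s => /negP.
  rewrite negb_and -leNgt -ltNge add0r => /orP[h|h].
  - rewrite (le_trans le1)// ler_wpDr// -expRD -[leLHS]expR0 ler_expR.
    rewrite mulNr subr_ge0 -mulrA -ler_pdivlMl// mulr1.
    by move: h; rewrite ler_pdivlMr// mulrC.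
  - rewrite ler_wpDl// -expRD ler_expR.
    by move: h; rewrite ltr_pdivrMr//; nra.
rewrite (potential_measure_tonelli subS)//.
have mP := measurable_subordinator_prob subS mA.
have mE c : measurable_fun (`[0%R, +oo[%classic : set R)
    (fun t : R => (expR (- t * c))%:E).
  apply/measurable_EFinP; apply: measurableT_comp => //.
  by apply: measurable_funM => //; exact: measurableT_comp.
have : ((phi l)^-1%:E <= \int[lebesgue_measure]_(t in `[0%R, +oo[)
    (P (S t @^-1` A) + (e%:E * (expR (- t * phi (k * l)))%:E +
      e'%:E * (expR (- t * phi (l / 2)))%:E)))%E.
  rewrite -integral_expRN//; apply: ge0_le_integral_subset => // t.
  - by move=> _; rewrite adde_ge0// adde_ge0// mule_ge0 ?lee_fin ?expR_ge0.
  - by move/halfline0P => /pointwise.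
rewrite ge0_integralD//; last 2 first.
- by move=> t _; rewrite adde_ge0// mule_ge0 ?lee_fin ?expR_ge0.
- by apply: emeasurable_funD; apply: measurable_funeM; exact: mE.
rewrite ge0_integralD//; last 4 first.
- by move=> t _; rewrite mule_ge0 ?lee_fin ?expR_ge0.
- by apply: measurable_funeM; exact: mE.
- by move=> t _; rewrite mule_ge0 ?lee_fin ?expR_ge0.
- by apply: measurable_funeM; exact: mE.
rewrite !ge0_integralZl//; last 2 first.
- exact: mE.
- exact: mE.
rewrite !integral_expRN//; set X := (\int[_]_(_ in _) _)%E => bound.
have b1 : e / phi (k * l) <= (4 * phi l)^-1.
  have := hk _ l0; set x := phi l in pl *; set y := phi (k * l) in pkl * => h.
  rewrite ler_pdivrMr// mulrC ler_pdivlMr ?mulr_gt0//.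
  by move: h; rewrite ler_pdivlMl ?mulr_gt0//; lra.
have b2 : e' / phi (l / 2) <= (4 * phi l)^-1.
  have := ha (l / 2) 2 l20 (ler1n _ 2); rewrite mulrC divfK// -/b.
  set x := phi l in pl *; set y := phi (l / 2) in pl2 * => h.
  rewrite ler_pdivrMr// mulrC ler_pdivlMr ?mulr_gt0//.
  apply: (@le_trans _ _ (4 * (e' * b) * y)); last by nra.
  by have := ler_wpM2l (ltW e'0) h; lra.
rewrite (_ : ((2 * phi l)^-1)%:E = (phi l)^-1%:E - ((2 * phi l)^-1)%:E)%E; last first.
  by rewrite -EFinB; congr EFin; field; rewrite gt_eqF.
rewrite leeBlDr//; apply: (le_trans bound); rewrite leeD2l//.
rewrite -!EFinM -EFinD lee_fin (le_trans (lerD b1 b2))//.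
by rewrite le_eqVlt; apply/orP; left; apply/eqP; field; rewrite gt_eqF.
Qed.

Variable u : R -> R.
Hypothesis hu : potential_density P S u.

Lemma integral_potential_density_le a : 0 < a ->
  (\int[lebesgue_measure]_(t in `]0%R, a]) (u t)%:E <=
   (expR 1 / phi a^-1)%:E)%E.
Proof.
move=> a0; have [_ <-] := hu.
- apply: potential_measure_le => // s.
  by rewrite /= in_itv/= => /andP[].
- exact: measurable_itv.
- by move=> s; rewrite /= !in_itv/= andbT => /andP[].
Qed.

Lemma green_lower d c1 c2 al be : 0 < c1 -> 0 < c2 -> 0 < al ->
  scales_below phi c1 al -> scales_above phi c2 be ->
  exists2 c, 0 < c & forall r, 0 < r ->
    ((c * (r ^- d * (phi (r ^- 2))^-1))%:E <= heat_mixture d u r)%E.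
Proof.
move=> c10 c20 al0 hb ha; have [cm hU] := hu.
have [eta [M [eta0 etaM hmass]]] := potential_mass_at_scale c10 c20 al0 hb ha.
have [c c0 hc] := heat_mixture_ge d eta0 etaM.
exists (c / 2); first by rewrite divr_gt0.
move=> r r0; have r20 : 0 < r ^- 2 by rewrite invr_gt0 exprn_gt0.
have p0 := phi_gt0 r20; have rd0 : 0 < r ^- d by rewrite invr_gt0 exprn_gt0.
apply: le_trans (hc u r r0 _ (completely_monotone_measurable cm)); last first.
  by move=> t; exact: completely_monotone_ge0.
rewrite -hU; last 2 first.
- exact: measurable_itv.
- move=> s; rewrite /= !in_itv/= andbT => /andP[h _]; apply: lt_trans h.
  by rewrite mulr_gt0// exprn_gt0.
have := hmass _ r20; rewrite !invrK => h.
apply: (@le_trans _ _ ((c * r ^- d)%:E * ((2 * phi (r ^- 2))^-1)%:E)%E); last first.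
  by rewrite lee_wpmul2l// lee_fin mulr_ge0 ?(ltW c0)// ltW.
rewrite -EFinM lee_fin [(2 * _)^-1]invfM le_eqVlt; apply/orP; left; apply/eqP.
by move: (r ^- d) (phi _)^-1 => x y; field.
Qed.

(** On the shell where t is of order 2^j r^2 the heat kernel has lost a factor
    2^(- j d/2), while the potential has grown by a factor of order at most
    2^(j be); the loss wins. *)
Lemma green_upper d c2 be : 0 < c2 -> 2 * be < d%:R -> scales_above phi c2 be ->
  exists2 c, 0 < c & forall r, 0 < r ->
    (heat_mixture d u r <= (c * (r ^- d * (phi (r ^- 2))^-1))%:E)%E.
Proof.
move=> c20 bed ha; have [cm _] := hu.
have u0 t : 0 < t -> 0 <= u t by exact: completely_monotone_ge0.
have mu := completely_monotone_measurable cm.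
have [C C1 hC] := @heat_profile_le_linear R d.
have C0 : 0 < C := lt_le_trans ltr01 C1.
pose p : R := d%:R / 2; have p0 : 0 <= p by rewrite divr_ge0.
pose q : R := 2 `^ (- p); pose q' : R := 2 `^ be * q.
have q0 : 0 <= q by exact: powR_ge0.
have q'01 : 0 <= q' < 1 by exact: dyadic_ratio.
pose K := C * 2 `^ p; have K0 : 0 < K by rewrite mulr_gt0// powR_gt0.
pose K' := expR 1 * c2; have K'0 : 0 < K' by rewrite mulr_gt0// expR_gt0.
have q'1 : 0 < 1 - q' by case/andP : q'01 => _; rewrite subr_gt0.
exists (K * (K' / (1 - q'))); first by rewrite mulr_gt0// divr_gt0.
move=> r r0; have r20 : 0 < r ^- 2 by rewrite invr_gt0 exprn_gt0.
have r2 : 0 < r ^+ 2 by rewrite exprn_gt0.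
have pr := phi_gt0 r20; have rd0 : 0 < r ^- d by rewrite invr_gt0 exprn_gt0.
pose A j : set R := `]0%R, (2 ^+ j * r ^+ 2)%R]%classic.
have a0 j : 0 < 2 ^+ j * r ^+ 2 by rewrite mulr_gt0// exprn_gt0.
have mA j : measurable (A j) by exact: measurable_itv.
have AD j : A j `<=` `]0%R, +oo[.
  by move=> t; rewrite /A /= !in_itv/= andbT => /andP[].
pose f j t := ((K * r ^- d * q ^+ j)%:E * ((EFin \o u) \_ (A j)) t)%E.
have uA0 j t : (0 <= ((EFin \o u) \_ (A j)) t)%E.
  by apply: erestrict_ge0 => s /AD /halflineP s0; rewrite lee_fin u0.
have f0 j t : (0 <= f j t)%E.
  by rewrite mule_ge0// lee_fin !mulr_ge0 ?exprn_ge0// ltW.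
have muA j : measurable_fun (`]0%R, +oo[%classic : set R) ((EFin \o u) \_ (A j)).
  apply: (measurable_restrict _ _ _).1 => //.
  by apply/measurable_EFinP; apply: measurable_funS mu => //.
have mf j : measurable_fun (`]0%R, +oo[%classic : set R) (f j) by exact: measurable_funeM.
have dom : (heat_mixture d u r <=
    \int[lebesgue_measure]_(t in `]0%R, +oo[) \sum_(j <oo) f j t)%E.
  apply: ge0_le_integral_subset => // t /halflineP t0.
  - by rewrite lee_fin !mulr_ge0 ?powR_ge0 ?expR_ge0 ?u0.
  - exact: nneseries_ge0.
  have x0 : 0 < t / r ^+ 2 by rewrite divr_gt0.
  have [] := @dyadic_shell_bound _ p _ (C^-1 * heat_profile d (t / r ^+ 2)) x0 p0.
  - rewrite mulrC ler_pdivrMr// mul1r (le_trans (hC _ x0))//.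
    by rewrite ler_piMr ?(ltW C0)// ge_min lexx.
  - rewrite (le_trans _ (heat_profile_le_powR d x0))//.
    by rewrite ler_piMl ?heat_profile_ge0// invf_le1.
  move=> j xj; rewrite mulrC ler_pdivrMr// => hj.
  apply: (@le_trans _ _ (f j t)); last first.
    rewrite (nneseriesD1 (n := j))//.
    by rewrite leeDl// nneseries_ge0.
  rewrite /f /patch ifT; last first.
    by rewrite inE /A /= in_itv/= t0 -ler_pdivrMr.
  rewrite -EFinM lee_fin heat_kernel_scaling// ler_wpM2r ?u0//.
  rewrite (mulrC K) -mulrA ler_wpM2l ?(ltW rd0)//.
  by rewrite (le_trans hj)// mulrC /K mulrA.
apply: (le_trans dom); rewrite integral_nneseries//.
rewrite [in leRHS](_ : _ * _ =
    (K * r ^- d * (phi (r ^- 2))^-1 * K') / (1 - q')); last by ring.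
apply: geometric_eseries_le => //.
- have pri : 0 < (phi (r ^- 2))^-1 by rewrite invr_gt0.
  exact: ltW (mulr_gt0 (mulr_gt0 (mulr_gt0 K0 rd0) pri) K'0).
- by move=> j; apply: integral_ge0 => t _; exact: f0.
move=> j; rewrite ge0_integralZl//; last 2 first.
- exact: muA.
- by rewrite lee_fin !mulr_ge0 ?exprn_ge0// ltW.
rewrite -integral_mkcondr (setIidr (@AD j)).
apply: (@le_trans _ _ ((K * r ^- d * q ^+ j)%:E *
    (expR 1 / phi (2 ^+ j * r ^+ 2)^-1)%:E)%E).
  apply: lee_wpmul2l; first by rewrite lee_fin !mulr_ge0 ?exprn_ge0// ltW.
  exact: integral_potential_density_le.
rewrite -EFinM lee_fin.
have := scales_above_dyadic j phi_gt0 ha r20; rewrite -invfM.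
set x := phi _ in pr *; set y := phi _; move=> h.
rewrite exprMn.
have -> : K * r ^- d / x * K' * ((2 `^ be) ^+ j * q ^+ j) =
  K * r ^- d * q ^+ j * (expR 1 * (c2 * (2 `^ be) ^+ j / x)).
  by rewrite /K'; ring.
have Kq0 : 0 <= K * r ^- d * q ^+ j.
  exact: mulr_ge0 (ltW (mulr_gt0 K0 rd0)) (exprn_ge0 j q0).
by rewrite (ler_wpM2l Kq0)// (ler_wpM2l (expR_ge0 1))// mulrA.
Qed.

End PotentialDensity.

(** * Trigonometric sums *)

Section TrigonometricSums.
Context {R : realType}.

Lemma cos_ge_cos1 (x : R) : `|x| <= 1 -> cos 1 <= cos x.
Proof.
move=> x1; have -> : cos x = cos `|x|.
  by case: (ger0P x) => // _; rewrite cosN.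
have pi2 := pi_ge2 R.
by rewrite leNgt ltr_cos -?leNgt// in_itv/= ?normr_ge0/= ?ler01; lra.
Qed.

Lemma sum_cos_sq_add_sum_sin_sq (I : finType) (x : I -> R) :
  (\sum_i cos (x i)) ^+ 2 + (\sum_i sin (x i)) ^+ 2 =
  \sum_i \sum_j cos (x i - x j).
Proof.
rewrite !expr2 !mulr_suml -big_split/=; apply: eq_bigr => i _.
rewrite !mulr_sumr -big_split/=; apply: eq_bigr => j _.
by rewrite cosB.
Qed.

(** The Gaussian weights are dominated by a geometric sequence on both sides of
    the diagonal. *)
Lemma gauss_row_sum_le (a N : nat) :
  \sum_(b < N) expR (- (a%:R - b%:R) ^+ 2) <= 3 :> R.
Proof.
pose q : R := expR (- 1); have q0 : 0 < q by exact: expR_gt0.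
have q2 : q <= 2^-1.
  by rewrite (_ : 2 = 1 + 1 :> R)//; exact: expRN_le_inv.
have gq (n : nat) : expR (- n%:R ^+ 2) <= q ^+ n :> R.
  rewrite /q -expRM_natl ler_expR mulrN1 lerN2 -natrX ler_nat.
  by case: n => // n; rewrite expnS expn1 leq_pmulr.
have q1 : 0 <= 1 - q by lra.
suff h : (1 - q) * \sum_(b < N) expR (- (a%:R - b%:R) ^+ 2) <= 1 + q - q ^+ a.+1.
  have := exprn_ge0 a.+1 (ltW q0); set s := \sum_(_ < _) _ in h * => qa.
  have s0 : 0 <= s by apply: sumr_ge0 => i _; exact: expR_ge0.
  by nra.
elim: a N => [|a IH] N.
  rewrite expr1 addrK.
  suff : (1 - q) * \sum_(b < N) expR (- (0%:R - b%:R) ^+ 2) <= 1 - q ^+ N.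
    by move/le_trans; apply; rewrite gerBl exprn_ge0// ltW.
  elim: N => [|N IH]; first by rewrite big_ord0 mulr0 expr0 subrr.
  rewrite big_ord_recr/= mulrDr [q ^+ N.+1]exprS.
  rewrite (_ : (0 - N%:R) ^+ 2 = N%:R ^+ 2 :> R); last by ring.
  by have := ler_wpM2l q1 (gq N); lra.
case: N => [|N].
  rewrite big_ord0 mulr0 -addrA addr_ge0// subr_ge0 -[leRHS]expr1.
  by rewrite ler_wiXn2l// ?(ltW q0)//; lra.
rewrite big_ord_recl/= mulrDr subr0.
have := ler_wpM2l q1 (gq a.+1); have := IH N.
under [in X in _ -> _ -> X]eq_bigr do
  rewrite /bump/= add1n -[X in X - _]natr1 -[X in _ - X]natr1 opprD addrACA subrr addr0.
by rewrite (exprS _ a.+1); set z := q ^+ a.+1; lra.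
Qed.

End TrigonometricSums.

(** * The Fejer bound for Brownian motion *)

Section BrownianMotion.
Context {R : realType} {dd : measure_display} {Omega : measurableType dd}.
Variables (P : probability Omega R) (d : nat) (W : R -> Omega -> 'rV[R]_d).
Hypothesis bmW : brownian_motion P W.

Lemma brownian_levy : levy_process P W. Proof. by case: bmW. Qed.

Lemma brownian_dot_measurable (xi : 'rV[R]_d) s : 0 <= s ->
  measurable_fun setT (fun w => dot xi (W s w)).
Proof.
move=> s0; apply: measurable_sum => i; apply: measurable_funM => //.
apply: (levy_measurable_comp (g := fun v : 'rV[R]_d => v 0 i) brownian_levy s0).
exact: coord_continuous.
Qed.

Lemma brownian_cos_integral (xi : 'rV[R]_d) s : 0 <= s ->
  (\int[P]_w (cos (dot xi (W s w)))%:E = (expR (- s * enorm xi ^+ 2))%:E)%E.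
Proof.
move=> s0; have [_ _ h _] := bmW; have := h xi s s0; rewrite unlock => <-.
apply: eq_integral => w _; have [_ [-> _ _ _ _]] := brownian_levy.
by rewrite subr0.
Qed.

Lemma brownian_cos_integrable (xi : 'rV[R]_d) s : 0 <= s ->
  P.-integrable setT (EFin \o (fun w => cos (dot xi (W s w)))).
Proof.
move=> s0; apply: measurable_bounded_integrable => //.
- by apply: (le_lt_trans (probability_le1 P measurableT)); rewrite ltry.
- apply: measurableT_comp; last exact: brownian_dot_measurable.
  by apply: continuous_measurable_fun; exact: continuous_cos.
- by exists 1; split => // M M1 w _; rewrite /= (le_trans _ (ltW M1))// cos_max.
Qed.

Lemma enorm_sqr (xi : 'rV[R]_d) : enorm xi ^+ 2 = \sum_i xi 0 i ^+ 2.
Proof.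
rewrite /enorm sqr_sqrtr; first by apply: eq_bigr => i _; rewrite expr2.
by apply: sumr_ge0 => i _; rewrite -expr2 sqr_ge0.
Qed.

Lemma dotBl (x y z : 'rV[R]_d) : dot (x - y) z = dot x z - dot y z.
Proof.
by rewrite /dot -sumrB; apply: eq_bigr => i _; rewrite !mxE mulrBl.
Qed.

Lemma normr_coord_le (x : 'rV[R]_d) i : `|x 0 i| <= `|x|.
Proof.
rewrite [leRHS]mx_normrE.
exact: (le_bigmax (0 : R) (fun ij : 'I_1 * 'I_d => `|x ij.1 ij.2|) (0, i)).
Qed.

(** The Fejer kernel of order N at mesh h, a nonnegative trigonometric
    polynomial, dominates the indicator of a ball of radius of order 1/(h N);
    its mean under the law of W_s is read off the characteristic function. Up to
    normalization the kernel is the squared modulus of the sum of the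
    exp (i h k.x) over the integer vectors k in [0, N)^d. *)
Lemma brownian_ball_fejer (M s h : R) (N : nat) : 0 < s -> 0 < h ->
  s * h ^+ 2 = 1 -> (0 < N)%N -> h * N%:R * d%:R * M <= 1 ->
  (P (W s @^-1` ball (0%R : 'rV[R]_d) M) <=
    ((3 / N%:R) ^+ d / cos 1 ^+ 2)%:E)%E.
Proof.
move=> s0 h0 sh N0 hM; have s0' := ltW s0.
have NR0 : 0 < N%:R :> R by rewrite ltr0n.
pose xi (k : {ffun 'I_d -> 'I_N}) : 'rV[R]_d := \row_i (h * (k i)%:R).
pose x k w := dot (xi k) (W s w).
pose F w := (\sum_k cos (x k w)) ^+ 2 + (\sum_k sin (x k w)) ^+ 2.
have cardK : #|{ffun 'I_d -> 'I_N}| = (N ^ d)%N by rewrite card_ffun !card_ord.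
have FE w : F w = \sum_k \sum_l cos (dot (xi k - xi l) (W s w)).
  rewrite /F sum_cos_sq_add_sum_sin_sq; apply: eq_bigr => k _.
  by apply: eq_bigr => l _; rewrite dotBl.
set B := W s @^-1` _.
have mB : measurable B.
  exact: levy_preimage_measurable brownian_levy s0' (ball_open _ _).
have BE w : B w -> `|W s w| < M.
  by rewrite /B /= -ball_normE /= sub0r normrN.
have c0 : 0 < cos 1 :> R := cos1_gt0 R.
have c20 : 0 < cos 1 ^+ 2 :> R by rewrite exprn_gt0.
have Nd0 : 0 < (N ^ d)%:R :> R by rewrite ltr0n expn_gt0 N0.
pose a : R := ((N ^ d)%:R * cos 1) ^+ 2.
have a0 : 0 < a by rewrite exprn_gt0// mulr_gt0.
have xi_le k w : B w -> `|x k w| <= 1.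
  move=> /BE Bw; apply: le_trans hM; rewrite /x /dot (le_trans (ler_norm_sum _ _ _))//.
  apply: (@le_trans _ _ (\sum_(i < d) (h * N%:R * M))).
    apply: ler_sum => i _; rewrite normrM mxE ger0_norm ?mulr_ge0 ?(ltW h0)//.
    rewrite ler_pM ?mulr_ge0 ?(ltW h0)//.
      by rewrite ler_wpM2l ?(ltW h0)// ler_nat ltnW.
    by rewrite (le_trans (normr_coord_le _ _))// ltW.
  by rewrite sumr_const card_ord -[leLHS]mulr_natr mulrAC.
have aF w : a * \1_B w <= F w.
  have F0 : 0 <= F w by rewrite addr_ge0// sqr_ge0.
  rewrite indicE; case: (boolP (w \in B)) => [/set_mem Bw|_]; last by rewrite mulr0.
  rewrite mulr1 /F ler_wpDr ?sqr_ge0// /a ler_sqr ?nnegrE ?mulr_ge0 ?(ltW c0)//.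
    rewrite -cardK mulr_natl -sumr_const ler_sum// => k _.
    exact/cos_ge_cos1/xi_le.
  by apply: sumr_ge0 => k _; rewrite (le_trans (ltW c0))// cos_ge_cos1// xi_le.
have EF : (\int[P]_w (F w)%:E =
    (\sum_k \sum_l expR (- s * enorm (xi k - xi l) ^+ 2))%:E)%E.
  under eq_integral do rewrite FE -sumEFin.
  rewrite integral_sum//; last first.
    move=> k; apply: (eq_integrable _ (fun w => \sum_l
      (EFin \o (fun w => cos (dot (xi k - xi l) (W s w)))) w)%E) => //.
      by move=> w _; rewrite /= -sumEFin.
    by apply: integrable_sum => // l _; exact: brownian_cos_integrable.
  rewrite -sumEFin; apply: eq_bigr => k _.
  under eq_integral do rewrite -sumEFin.
  rewrite integral_sum//; last by move=> l; exact: brownian_cos_integrable.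
  by rewrite -sumEFin; apply: eq_bigr => l _; rewrite brownian_cos_integral.
have Fle : \sum_k \sum_l expR (- s * enorm (xi k - xi l) ^+ 2) <=
    (N ^ d)%:R * 3 ^+ d.
  rewrite -cardK mulr_natl -sumr_const ler_sum// => k _.
  (* For fixed k the sum over l is a product over the coordinates. *)
  have -> : \sum_l expR (- s * enorm (xi k - xi l) ^+ 2) =
      \prod_(i < d) \sum_(b < N) expR (- ((k i)%:R - b%:R) ^+ 2).
    rewrite bigA_distr_bigA; apply: eq_bigr => l _.
    rewrite -expR_sum; congr expR; rewrite enorm_sqr mulr_sumr.
    apply: eq_bigr => i _; rewrite !mxE -mulrBr exprMn mulrA mulNr sh.
    by rewrite mulN1r.
  rewrite -[X in _ <= _ ^+ X]card_ord -prodr_const ler_prod// => i _.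
  by rewrite gauss_row_sum_le sumr_ge0// => b _; exact: expR_ge0.
have mF : measurable_fun setT (EFin \o F).
  apply/measurable_EFinP.
  by apply: measurable_funD; apply: measurable_funX; apply: measurable_sum => k;
    apply: measurableT_comp; try exact: brownian_dot_measurable;
    apply: continuous_measurable_fun; [exact: continuous_cos|exact: continuous_sin].
have : (a%:E * P B <= ((N ^ d)%:R * 3 ^+ d)%:E)%E.
  apply: (@le_trans _ _ (\int[P]_w (F w)%:E)%E); last by rewrite EF lee_fin.
  rewrite -[X in P X]setIT -integral_indic// -ge0_integralZl//; last 2 first.
  - by apply/measurable_EFinP; exact: measurable_indic.
  - by rewrite lee_fin ltW.
  apply: ge0_le_integral_subset => // w _; rewrite -?EFinM lee_fin//.
  - by rewrite mulr_ge0 ?(ltW a0).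
  - by rewrite addr_ge0// sqr_ge0.
rewrite -lee_pdivlMl// -EFinM => /le_trans; apply; rewrite lee_fin.
rewrite /a natrX le_eqVlt; apply/orP; left; apply/eqP.
rewrite expr_div_n; move: (N%:R ^+ d) (exprn_gt0 d NR0) => z z0.
by field; rewrite !gt_eqF.
Qed.

End BrownianMotion.

(** * Decay of Brownian ball probabilities *)

Section BrownianDecay.
Context {R : realType} {dd : measure_display} {Omega : measurableType dd}.
Variables (P : probability Omega R) (d : nat) (W : R -> Omega -> 'rV[R]_d).
Hypothesis bmW : brownian_motion P W.

Lemma brownian_ball_measurable M s : 0 <= s ->
  measurable (W s @^-1` ball (0%R : 'rV[R]_d) M).
Proof.
move=> s0; exact: levy_preimage_measurable (brownian_levy bmW) s0 (ball_open _ _).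
Qed.

(** The mesh is of order s^(-1/2), so that the means of the nonconstant terms
    are summable, and the order of the kernel is the largest for which the ball
    stays in its main lobe. *)
Lemma brownian_ball_decay (M : R) : (0 < d)%N -> 0 < M ->
  exists2 C, 1 <= C & forall s, 0 < s ->
    (P (W s @^-1` ball (0%R : 'rV[R]_d) M) <= (C * s `^ (- (d%:R / 2)))%:E)%E.
Proof.
move=> d0 M0; pose L : R := d%:R * M; have L0 : 0 < L by rewrite mulr_gt0 ?ltr0n.
have c0 : 0 < cos 1 ^+ 2 :> R by rewrite exprn_gt0// cos1_gt0.
have L60 : 0 < 6 * L by rewrite mulr_gt0.
have Ld : 0 <= L ^+ d by rewrite exprn_ge0// ltW.
have L6d : 0 <= (6 * L) ^+ d / cos 1 ^+ 2.
  by rewrite divr_ge0 ?(ltW c0)// exprn_ge0// ltW.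
exists (1 + L ^+ d + (6 * L) ^+ d / cos 1 ^+ 2).
  by rewrite -addrA lerDl addr_ge0.
move=> s s0; have r0 : 0 < Num.sqrt s by rewrite sqrtr_gt0.
have -> : s `^ (- (d%:R / 2)) = (Num.sqrt s) ^- d.
  by rewrite mulrC powRN powRrM powR12_sqrt ?ltW// powR_mulrn ?sqrtr_ge0.
have rd0 : 0 < Num.sqrt s ^+ d by rewrite exprn_gt0.
have [x1|x1] := ltP (Num.sqrt s / L) 1.
  apply: (@le_trans _ _ 1%E).
    exact: probability_le1 (brownian_ball_measurable _ (ltW s0)).
  rewrite lee_fin ler_pdivlMr// mul1r.
  have : Num.sqrt s ^+ d <= L ^+ d.
    rewrite lerXn2r ?nnegrE ?(ltW r0) ?(ltW L0)// ltW//.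
    by move: x1; rewrite ltr_pdivrMr// mul1r.
  by lra.
have x0 : 0 < Num.sqrt s / L by rewrite (lt_le_trans ltr01).
set x := Num.sqrt s / L in x1 x0.
have /andP[Nx xN] := truncn_itv (ltW x0).
set N := Num.trunc x in Nx xN.
have N0 : (0 < N)%N by rewrite lt0n; apply: contraTneq xN => ->; rewrite -leNgt.
have NR0 : 0 < N%:R :> R by rewrite ltr0n.
have N1 : 1 <= N%:R :> R by rewrite ler1n.
have h0 : 0 < (Num.sqrt s)^-1 by rewrite invr_gt0.
apply: (le_trans (brownian_ball_fejer bmW s0 h0 _ N0 _)).
- by rewrite exprVn sqr_sqrtr ?ltW// divff// gt_eqF.
- rewrite (_ : _ * M = N%:R / x); last first.
    by rewrite /x /L; field; rewrite !gt_eqF// ltr0n.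
  by rewrite ler_pdivrMr// mul1r.
rewrite lee_fin.
have x2 : 3 / N%:R <= 6 * L / Num.sqrt s.
  have -> : 6 * L / Num.sqrt s = 6 / x.
    by rewrite /x; field; rewrite !gt_eqF.
  rewrite ler_pdivrMr// mulrAC ler_pdivlMr//.
  by move: xN; rewrite -natr1; lra.
have : (3 / N%:R) ^+ d <= (6 * L) ^+ d / Num.sqrt s ^+ d.
  rewrite -(expr_div_n (6 * L)) lerXn2r ?nnegrE//.
  by apply: divr_ge0; exact: ltW.
rewrite -(ler_pM2r (_ : 0 < (cos 1 ^+ 2)^-1)) ?invr_gt0// => /le_trans; apply.
rewrite mulrAC ler_wpM2r ?invr_ge0 ?(ltW rd0)//.
by lra.
Qed.

End BrownianDecay.

(** * Transience *)

Section Transience.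
Context {R : realType} {dd : measure_display} {Omega : measurableType dd}.
Variables (P : probability Omega R) (phi : R -> R) (d : nat)
  (S : R -> Omega -> R) (W : R -> Omega -> 'rV[R]_d).
Hypothesis subS : subordinator P phi S.
Hypothesis bmW : brownian_motion P W.
Hypothesis indWS : independent_processes P W S.

Lemma subordinator_preimage_measurable t (A : set R) : 0 <= t -> measurable A ->
  measurable (S t @^-1` A).
Proof.
by move=> t0 mA; have := subordinator_measurable subS t0 measurableT mA; rewrite setTI.
Qed.

Lemma measurable_borel (A : set R) : measurable A -> borel A.
Proof.
move=> mA; have {mA} : (@RGenOpens.G R).-sigma.-measurable A.
  by rewrite -RGenOpens.measurableE.
apply: smallest_sub; first exact: smallest_sigma_algebra.
by move=> _ [a [b ->]]; apply: sub_gen_smallest; exact: interval_open.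
Qed.

Lemma subordination_independence M s t (A : set R) : 0 <= s -> 0 <= t ->
  measurable A ->
  (P ((S t @^-1` A) `&` (W s @^-1` ball (0%R : 'rV[R]_d) M)) =
   P (S t @^-1` A) * P (W s @^-1` ball (0%R : 'rV[R]_d) M))%E.
Proof.
move=> s0 t0 mA; rewrite setIC muleC; apply: indWS; apply: sub_gen_smallest.
- exists s, (ball (0 : 'rV[R]_d) M); split => //.
  exact: sub_gen_smallest (ball_open _ _).
- by exists t, A; split => //; exact: measurable_borel.
Qed.

(** S_t rounded up to the grid of mesh 1/(n+1), which makes the Brownian motion
    run until a time with countably many values. Negative times are sent to 0
    only to have an event of the product space. *)
Definition grid_event M n : set (Omega * R) :=
  \bigcup_k ([set z | S (Num.max z.2 0) z.1 \in
                        `[k%:R / n.+1%:R, k.+1%:R / n.+1%:R[] `&`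
             [set z | ball (0 : 'rV[R]_d) M (W (k.+1%:R / n.+1%:R) z.1)]).

Lemma grid_event_measurable M n : measurable (grid_event M n).
Proof.
apply: bigcupT_measurable => k; apply: measurableI.
  exact: subordinator_event_jointly_measurable subS _ (measurable_itv _).
have -> : [set z : Omega * R | ball (0 : 'rV[R]_d) M (W (k.+1%:R / n.+1%:R) z.1)] =
    (W (k.+1%:R / n.+1%:R) @^-1` ball (0 : 'rV[R]_d) M) `*` setT.
  by apply/seteqP; split => z //= [].
by apply: measurableX => //; apply: (brownian_ball_measurable bmW); rewrite divr_ge0.
Qed.

(** Independence turns the probability into a sum over the grid values of the
    rounded time. Exchanging it with the dyadic sum leaves, for each j, the
    probability that the rounded time is at most 2^j; S_t is then at most 2^j as
    well, and Markov's inequality applies. *)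
Lemma grid_event_prob_le M n t (b : nat -> R) : (forall j, 0 <= b j) -> 0 <= t ->
  (forall s, 0 < s -> (P (W s @^-1` ball (0%R : 'rV[R]_d) M) <=
    \sum_(j <oo) (if (s <= 2 ^+ j)%R then (b j)%:E else 0))%E) ->
  (P (ysection (grid_event M n) t) <=
    \sum_(j <oo) ((b j)%:E * (expR 1 * expR (- t * phi ((2 ^+ j)^-1)))%:E))%E.
Proof.
move=> b0 t0 hb; pose late k : R := k.+1%:R / n.+1%:R.
have n0 : 0 < n.+1%:R :> R by rewrite ltr0n.
have late0 k : 0 < late k by rewrite divr_gt0 ?ltr0n.
pose I k : set R := `[k%:R / n.+1%:R, late k[%classic.
have mI k : measurable (I k) by exact: measurable_itv.
pose F k := (S t @^-1` I k) `&` (W (late k) @^-1` ball (0 : 'rV[R]_d) M).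
have mSI k := subordinator_preimage_measurable t0 (mI k).
have mF k : measurable (F k).
  by apply: measurableI => //; exact: (brownian_ball_measurable bmW _ (ltW (late0 k))).
have tI : trivIset setT (fun k => S t @^-1` I k).
  apply/trivIsetP => i j _ _ ij; apply/seteqP; split => w // [].
  rewrite /I /late /= !in_itv/= => /andP[i1 i2] /andP[j1 j2].
  have := le_lt_trans i1 j2; have := le_lt_trans j1 i2.
  rewrite !ltr_pM2r ?invr_gt0// !ltr_nat !ltnS => h1 h2.
  by move: ij; rewrite (anti_leq (introT andP (conj h2 h1))) eqxx.
pose c k j : \bar R := (if (late k <= 2 ^+ j)%R then P (S t @^-1` I k) else 0)%E.
have c0 k j : (0 <= c k j)%E by rewrite /c; case: ifP.
apply: (@le_trans _ _ (\sum_(k <oo) P (F k))%E).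
  apply: measure_sigma_subadditive => //.
    exact: measurable_ysection (grid_event_measurable _ _).
  move=> w; rewrite /ysection /= inE => -[k _ [/= h1 h2]]; exists k => //.
  by split => //=; move: h1; rewrite max_l.
apply: (@le_trans _ _ (\sum_(k <oo) \sum_(j <oo) ((b j)%:E * c k j))%E).
  apply: lee_nneseries => [k _ _|k _]; first exact: measure_ge0.
  rewrite /F (subordination_independence _ (ltW (late0 k)) t0)//.
  apply: (@le_trans _ _ (P (S t @^-1` I k) *
    \sum_(j <oo) (if (late k <= 2 ^+ j)%R then (b j)%:E else 0))%E).
    by apply: lee_wpmul2l => //; exact: hb.
  have /fineK <- : P (S t @^-1` I k) \is a fin_num by exact: fin_num_measure.
  rewrite -nneseriesZl => [|j _]; last by case: ifP => _; rewrite ?lee_fin.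
  apply: lee_nneseries => [j _ _|j _].
    by apply: mule_ge0; [rewrite lee_fin fine_ge0|case: ifP => _; rewrite ?lee_fin].
  rewrite /c; case: ifP => _; last by rewrite !mule0.
  by rewrite fineK ?fin_num_measure// muleC.
rewrite nneseries_interchange; last first.
  by move=> k j; rewrite mule_ge0// lee_fin.
apply: lee_nneseries => [j _ _|j _].
  by apply: nneseries_ge0 => k _ _; rewrite mule_ge0// lee_fin.
rewrite nneseriesZl//; apply: lee_wpmul2l; first by rewrite lee_fin.
pose D := [set k | late k <= 2 ^+ j].
have mID : measurable (\bigcup_(k in D) I k) by exact: bigcup_measurable.
apply: le_trans (subordinator_prob_le (a := 2 ^+ j) subS mID _ _ t0).
- rewrite preimage_bigcup measure_bigcup//; last exact: sub_trivIset tI.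
  rewrite [leRHS]eseries_mkcond; apply: lee_nneseries => // k _; rewrite /c.
  by rewrite [in leRHS](_ : (k \in D) = (late k <= 2 ^+ j))//; apply/idP/idP; rewrite inE.
- move=> s [k Dk]; rewrite /I /= in_itv/= => /andP[_ /ltW sk].
  exact: le_trans sk Dk.
- by rewrite exprn_gt0.
Qed.

(** By right-continuity a path that is in the open ball at time S_t stays there
    shortly after, hence at all fine enough grid times. *)
Lemma grid_event_eventually M t w : 0 <= t ->
  ball (0 : 'rV[R]_d) M (W (S t w) w) ->
  exists n0, forall n, (n0 <= n)%N -> grid_event M n (w, t).
Proof.
move=> t0 Bw; have S0 := subordinator_ge0 subS w t0.
have [_ [_ _ _ rc _]] := brownian_levy bmW.
have : \forall r \near (S t w)^'+, ball (0 : 'rV[R]_d) M (W r w).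
  have nB : nbhs (W (S t w) w) (ball (0 : 'rV[R]_d) M).
    by apply: open_nbhs_nbhs; split; [exact: ball_open|exact: Bw].
  exact: (rc w (S t w) S0 _ nB).
case=> e /= e0 he.
exists (Num.trunc e^-1) => n en; have n0 : 0 < n.+1%:R :> R by rewrite ltr0n.
have := truncn_itv (mulr_ge0 S0 (ltW n0)).
set k := Num.trunc _ => /andP[k1 k2].
have h1 : k%:R / n.+1%:R <= S t w by rewrite ler_pdivrMr.
have h2 : S t w < k.+1%:R / n.+1%:R by rewrite ltr_pdivlMr.
exists k => //; split; rewrite /= ?max_l//.
  by rewrite in_itv/= h1 h2.
apply: he => //=; rewrite ltr0_norm ?subr_lt0// opprB.
have ei : e^-1 < n.+1%:R.
  have ei0 : 0 <= e^-1 by rewrite invr_ge0 ltW.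
  have /andP[_ ei] := truncn_itv ei0.
  by rewrite (lt_le_trans ei)// ler_nat ltnS.
rewrite (@le_lt_trans _ _ n.+1%:R^-1)//; last first.
  by rewrite invf_plt ?posrE.
have -> : k.+1%:R / n.+1%:R = k%:R / n.+1%:R + n.+1%:R^-1 :> R.
  by rewrite -natr1 mulrDl mul1r.
by rewrite lerBlDr addrC lerD2l.
Qed.

(** By Tonelli, the expected time spent in a ball is at most the integral over t
    of the bound on the grid events, a dyadic sum with terms of order
    2^(- j d/2) / phi (2^-j). *)
Lemma subordinate_transient (c2 be : R) : (0 < d)%N ->
  (forall l, 0 < l -> 0 < phi l) -> 0 < c2 -> 2 * be < d%:R ->
  scales_above phi c2 be -> transient P (subordinate W S).
Proof.
move=> d0 phi0 c20 bed ha K cK.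
have [M0 [_ KM0]] := compact_bounded cK.
(* Every real greater than M0 bounds K. *)
pose M := Num.max M0 0 + 2.
have MM0 : M0 < Num.max M0 0 + 1 by rewrite ltr_pwDr// le_max lexx.
have M00 : 0 < M by rewrite ltr_wpDl// le_max lexx orbT.
have KB x : K x -> ball (0 : 'rV[R]_d) M x.
  move=> Kx; rewrite -ball_normE /= sub0r normrN.
  by rewrite (le_lt_trans (KM0 _ MM0 x Kx))// /M; lra.
have [C C1 hC] := brownian_ball_decay bmW d0 M00.
have C0 : 0 < C := lt_le_trans ltr01 C1.
pose p : R := d%:R / 2; have p0 : 0 <= p by rewrite divr_ge0.
pose q : R := 2 `^ (- p); pose q' : R := 2 `^ be * q.
have q0 : 0 <= q by exact: powR_ge0.
have q'01 : 0 <= q' < 1 by exact: dyadic_ratio.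
pose b j : R := C * (2 `^ p * q ^+ j).
have b0 j : 0 <= b j by rewrite mulr_ge0 ?mulr_ge0 ?powR_ge0 ?exprn_ge0// ltW.
have hb s : 0 < s -> (P (W s @^-1` ball (0%R : 'rV[R]_d) M) <=
    \sum_(j <oo) (if (s <= 2 ^+ j)%R then (b j)%:E else 0))%E.
  move=> s0; set A := _ @^-1` _.
  have mA : measurable A by exact: (brownian_ball_measurable bmW _ (ltW s0)).
  have PA : P A = (fine (P A))%:E by rewrite fineK// fin_num_measure.
  have := hC s s0; have := probability_le1 P mA; rewrite -/A PA !lee_fin => PA1 PAs.
  have [] := @dyadic_shell_bound _ p s (C^-1 * fine (P A)) s0 p0.
  - rewrite mulrC ler_pdivrMr// mul1r (le_trans PA1)//.
  - by rewrite mulrC ler_pdivrMr// mulrC.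
  move=> j sj; rewrite mulrC ler_pdivrMr// mulrC => hj.
  rewrite (nneseriesD1 (n := j))//; last by move=> k _; case: ifP; rewrite ?lee_fin.
  rewrite sj; apply: (@le_trans _ _ (b j)%:E); first by rewrite lee_fin.
  by rewrite leeDl// nneseries_ge0// => k _ _; case: ifP; rewrite ?lee_fin.
have term0 j x : (0 <= (b j)%:E * (expR 1 * expR x)%:E)%E.
  rewrite -EFinM lee_fin.
  exact: mulr_ge0 (b0 j) (mulr_ge0 (expR_ge0 _) (expR_ge0 _)).
pose Psi t := (\sum_(j <oo)
  ((b j)%:E * (expR 1 * expR (- t * phi ((2 ^+ j)^-1)))%:E))%E.
(* The union of the D m is the lower limit of the grid events; it contains every
   (w, t) whose path is in K at time t. *)
pose D m : set (Omega * R) := \bigcap_(n in [set n | (m <= n)%N]) grid_event M n.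
have mD m : measurable (D m).
  by apply: bigcap_measurableType => n _; exact: grid_event_measurable.
have mE : measurable (\bigcup_m D m) by exact: bigcupT_measurable.
have PE t : 0 <= t -> (P (ysection (\bigcup_m D m) t) <= Psi t)%E.
  move=> t0; rewrite ysection_bigcup.
  have mDt m : measurable (ysection (D m) t) by exact: measurable_ysection.
  have ndD : nondecreasing_seq (fun m => ysection (D m) t).
    move=> m m' mm'; apply/subsetPset => w; rewrite /ysection /= !inE => Dw n /= m'n.
    by apply: Dw; exact: leq_trans m'n.
  have := nondecreasing_cvg_mu (mu := P) mDt (bigcupT_measurable _ mDt) ndD.
  move/cvg_lim => <-//; apply: lime_le.
    apply: ereal_nondecreasing_is_cvgn => m m' mm'; apply: le_measure; rewrite ?inE//.
    exact/subsetPset/ndD.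
  apply: nearW => m /=; apply: le_trans (grid_event_prob_le m b0 t0 hb).
  apply: le_measure; rewrite ?inE//.
    exact: measurable_ysection (grid_event_measurable _ _).
  by move=> w; rewrite /ysection /= !inE; apply; rewrite /=.
apply: (@le_lt_trans _ _ (\int[lebesgue_measure]_(t in `[0%R, +oo[) Psi t)%E).
  apply: (@le_trans _ _ (\int[P]_w \int[lebesgue_measure]_(t in `[0%R, +oo[)
      (\1_(\bigcup_m D m) (w, t))%:E)%E).
    apply: ge0_le_integral_subset => // [w _|w _|w _].
    - by apply: integral_ge0.
    - by apply: integral_ge0.
    apply: ge0_le_integral_subset => // t /halfline0P t0; rewrite lee_fin.
    rewrite indicE; case: (boolP (_ \in K)) => [/set_mem Kx|_]; last first.
      by rewrite indicE.
    have [n0 hn0] := grid_event_eventually t0 (KB _ Kx).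
    by rewrite indicE mem_set//; exists n0.
  rewrite tonelli_halfline0//; apply: ge0_le_integral_subset => // t /halfline0P t0.
  - by apply: nneseries_ge0 => j _ _; exact: term0.
  - exact: PE.
have mexp c : measurable_fun (`[0%R, +oo[%classic : set R)
    (fun t : R => (expR 1 * expR (- t * c))%:E).
  apply/measurable_EFinP; apply: measurable_funM => //; apply: measurableT_comp => //.
  by apply: measurable_funM => //; exact: measurableT_comp.
rewrite integral_nneseries//; last first.
  by move=> j; apply: measurable_funeM; exact: mexp.
pose K' := C * 2 `^ p * expR 1 * c2 / phi 1.
apply: (@le_lt_trans _ _ (K' / (1 - q'))%:E); last exact: ltry.
apply: geometric_eseries_le => //.
- rewrite /K' divr_ge0 ?(ltW (phi0 _ _))// !mulr_ge0 ?powR_ge0 ?expR_ge0//; exact: ltW.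
- by move=> j; apply: integral_ge0 => t _; exact: term0.
move=> j; have p2 : 0 < (2 ^+ j)^-1 :> R by rewrite invr_gt0 exprn_gt0.
rewrite ge0_integralZl//; last 2 first.
- exact: mexp.
- by rewrite lee_fin.
under eq_integral do rewrite EFinM.
rewrite ge0_integralZl//; last first.
  apply/measurable_EFinP; apply: measurableT_comp => //.
  by apply: measurable_funM => //; exact: measurableT_comp.
rewrite integral_expRN ?phi0// -!EFinM lee_fin.
have := scales_above_dyadic j phi0 ha ltr01; rewrite mulr1 => h.
rewrite exprMn.
have -> : K' * ((2 `^ be) ^+ j * q ^+ j) =
  b j * (expR 1 * (c2 * (2 `^ be) ^+ j / phi 1)).
  by rewrite /K' /b; ring.
by rewrite ler_wpM2l// ler_wpM2l// expR_ge0.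
Qed.

End Transience.

(** * Comparison at all scales *)

Lemma enorm_gt0 (R : realType) (d : nat) (x : 'rV[R]_d) : x != 0 -> 0 < enorm x.
Proof.
move=> x0; rewrite lt_def sqrtr_ge0 andbT; apply: contraNneq x0 => e0.
have := enorm_sqr x; rewrite e0 expr0n/= => /esym/eqP.
rewrite psumr_eq0 => [/allP h|i _]; last exact: sqr_ge0.
apply/eqP/rowP => i; rewrite mxE; apply/eqP.
by have := h i (mem_index_enum i); rewrite sqrf_eq0.
Qed.

Theorem theorem3p4 (R : realType) (d : nat) (phi mu : R -> R)
    (delta1 delta2 delta3 delta4 a1 a2 a3 a4 : R)
    (hd : (1 <= d)%N)
    (hphi : complete_bernstein phi mu)
    (hphi1 : phi 1 = 1)
    (hdelta12 : 0 < delta1 /\ delta1 <= delta2 /\ delta2 < 1)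
    (hdelta34 : 0 < delta3 /\ delta3 <= delta4 /\ delta4 < 1)
    (ha : [/\ 0 < a1, 0 < a2, 0 < a3 & 0 < a4])
    (hinfty : forall r s : R, 1 <= r -> r <= s ->
      a1 * (s / r) `^ delta1 <= phi s / phi r /\
      phi s / phi r <= a2 * (s / r) `^ delta2)
    (hzero : forall r s : R, 0 < r -> r <= s -> s <= 1 ->
      a3 * (s / r) `^ delta3 <= phi s / phi r /\
      phi s / phi r <= a4 * (s / r) `^ delta4) :
  comparable_on [set x : 'rV[R]_d | x != 0]
    (levy_jump_density mu)
    (fun x => enorm x ^- d * phi (enorm x ^- 2))
  /\
  (2 * Num.max delta2 delta4 < d%:R ->
   forall (dd : measure_display) (Omega : measurableType dd)
     (P : probability Omega R) (S : R -> Omega -> R)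
     (W : R -> Omega -> 'rV[R]_d) (u : R -> R),
     subordinator P phi S ->
     brownian_motion P W ->
     independent_processes P W S ->
     potential_density P S u ->
     transient P (subordinate W S) /\
     comparable_on [set x : 'rV[R]_d | x != 0]
       (green_function u)
       (fun x => enorm x ^- d * (phi (enorm x ^- 2))^-1)).
Proof.
have [phi0 _ _ _] := hphi.
have [d1 [d12 d2]] := hdelta12; have [d3 [d34 d4]] := hdelta34.
have [c1 [c2 [c10 c20 below above]]] := global_scaling phi0 ha hinfty hzero.
have al0 : 0 < Num.min delta1 delta3 by rewrite lt_min d1.
have be1 : Num.max delta2 delta4 < 1 by rewrite gt_max d2.
split.
  have [c c_ge1 hc] :=
    levy_jump_density_comparable d hphi c10 c20 al0 be1 below above.
  by exists c; split => // x /enorm_gt0; exact: hc.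
move=> hdim dd Omega P S W u subS bmW indWS hu; split.
  exact: (subordinate_transient subS bmW indWS hd phi0 c20 hdim above).
have [c c0 lower] := green_lower subS phi0 hu d c10 c20 al0 below above.
have [C C0 upper] := green_upper subS phi0 hu c20 hdim above.
exists (1 + C + c^-1).
have ci0 : 0 < c^-1 by rewrite invr_gt0.
split; first by lra.
move=> x /enorm_gt0 r0; rewrite /green_function.
have h0 : 0 <= enorm x ^- d * (phi (enorm x ^- 2))^-1.
  rewrite mulr_ge0// invr_ge0 ?exprn_ge0 ?ltW// phi0// invr_gt0 exprn_gt0//.
apply/andP; split.
  apply: le_trans (lower _ r0); rewrite lee_fin ler_wpM2r//.
  by rewrite -[leRHS]invrK lef_pV2 ?posrE//; lra.
apply: le_trans (upper _ r0) _; rewrite lee_fin ler_wpM2r//; lra.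
Qed.
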